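(* Let $\mathcal W$ be a measure matrix, $Q(x)=\prod_{i=1}^s(x-q_i)^{n_i}=Q_0+Q_1x+\dots+Q_{N-1}x^{N-1}+x^N$, $N=\sum_i n_i$, with distinct real $q_i$ and $\{q_i\}_i\cap\Omega=\varnothing$, and let $\check{\mathcal W}_L,\check{\mathcal W}_R$ be the Geronimus–Sobolev deformed measure matrices; assume $G_{\mathcal W},G_{\check{\mathcal W}_L},G_{\check{\mathcal W}_R}$ are $LU$-factorizable. For $l\ge0$ put $\Phi^R_l:=\Pi_q[(C_1)_l]-\Pi_q[(P_1)_l]\Xi_R$ and $\Phi^L_l:=\Pi_q[(C_2)_l]-\Pi_q[(P_2)_l]\Xi_L$ (row vectors of length $N$), and for $k\ge N$ let $\Phi^{Z}_{[k-N,k-1]}$ be the $N\times N$ matrix with rows $\Phi^Z_{k-N},\dots,\Phi^Z_{k-1}$ ($Z=R,L$). Then for every $k\ge N$ $$(\check P_{1R})_k(x)=\Theta_*\left[\begin{array}{c|c}\Phi^R_{[k-N,k-1]}&\begin{matrix}(P_1)_{k-N}(x)\\ \vdots\\ (P_1)_{k-1}(x)\end{matrix}\\ \hline \Phi^R_k&(P_1)_k(x)\end{array}\right],\qquad (\check h_R)_k=h_{k-N}\,\Theta_*\left[\begin{array}{c|c}\Phi^R_{[k-N,k-1]}&\begin{matrix}1\\0\\ \vdots\\0\end{matrix}\\ \hline \Phi^R_k&0\end{array}\right],$$ $$\frac{(\check P_{2R})_k(x)}{(\check h_R)_k}=\Theta_*\left[\begin{array}{c|c}\Phi^R_{[k-N,k-1]}&\begin{matrix}1\\0\\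 \vdots\\0\end{matrix}\\ \hline Q(x)\big(\Pi_q[\mathcal K_2^{[k]}(x,\cdot)]-\Pi_q[K^{[k]}(x,\cdot)]\Xi_R\big)+(\chi^{[N]}(x))^\top\mathbf Q^{[N]}\Pi_q[\chi^{[N]}]&0\end{array}\right],$$ and $$(\check P_{2L})_k(x)=\Theta_*\left[\begin{array}{c|c}\Phi^L_{[k-N,k-1]}&\begin{matrix}(P_2)_{k-N}(x)\\ \vdots\\ (P_2)_{k-1}(x)\end{matrix}\\ \hline \Phi^L_k&(P_2)_k(x)\end{array}\right],\qquad (\check h_L)_k=h_{k-N}\,\Theta_*\left[\begin{array}{c|c}\Phi^L_{[k-N,k-1]}&\begin{matrix}1\\0\\ \vdots\\0\end{matrix}\\ \hline \Phi^L_k&0\end{array}\right],$$ $$\frac{(\check P_{1L})_k(x)}{(\check h_L)_k}=\Theta_*\left[\begin{array}{c|c}\Phi^L_{[k-N,k-1]}&\begin{matrix}1\\0\\ \vdots\\0\end{matrix}\\ \hline Q(x)\big(\Pi_q[\mathcal K_1^{[k]}(\cdot,x)]-\Pi_q[K^{[k]}(\cdot,x)]\Xi_L\big)+(\chi^{[N]}(x))^\top\mathbf Q^{[N]}\Pi_q[\chi^{[N]}]&0\end{array}\right].$$ For $k<N$, with the $N\times N$ matrices $\mathring\Pi_Z:=\Phi^Z_{[0,N-1]}\big(\mathbf Q^{[N]}\Pi_q[\chi^{[N]}]\big)^{-1}$ ($Z=R,L$), one has $$(\check P_{1R})_k(x)=\Theta_*\left[\begin{array}{c|c}\mathring\Pi_R^{[k]}&\begin{matrix}(P_1)_0(x)\\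 \vdots\\ (P_1)_{k-1}(x)\end{matrix}\\ \hline \begin{matrix}(\mathring\Pi_R)_{k,0}&\cdots&(\mathring\Pi_R)_{k,k-1}\end{matrix}&(P_1)_k(x)\end{array}\right],\quad (\check P_{2R})_k(x)=\Theta_*\left[\begin{array}{c|c}(\mathring\Pi_R^\top)^{[k]}&\begin{matrix}1\\ \vdots\\ x^{k-1}\end{matrix}\\ \hline \begin{matrix}(\mathring\Pi_R^\top)_{k,0}&\cdots&(\mathring\Pi_R^\top)_{k,k-1}\end{matrix}&x^k\end{array}\right],$$ $$(\check h_R)_k=-\Theta_*\left[\begin{array}{c|c}\mathring\Pi_R^{[k]}&\begin{matrix}(\mathring\Pi_R)_{0,k}\\ \vdots\\ (\mathring\Pi_R)_{k-1,k}\end{matrix}\\ \hline \begin{matrix}(\mathring\Pi_R)_{k,0}&\cdots&(\mathring\Pi_R)_{k,k-1}\end{matrix}&(\mathring\Pi_R)_{k,k}\end{array}\right],$$ $$(\check P_{2L})_k(x)=\Theta_*\left[\begin{array}{c|c}\mathring\Pi_L^{[k]}&\begin{matrix}(P_2)_0(x)\\ \vdots\\ (P_2)_{k-1}(x)\end{matrix}\\ \hline \begin{matrix}(\mathring\Pi_L)_{k,0}&\cdots&(\mathring\Pi_L)_{k,k-1}\end{matrix}&(P_2)_k(x)\end{array}\right],\quad (\check P_{1L})_k(x)=\Theta_*\left[\begin{array}{c|c}(\mathring\Pi_L^\top)^{[k]}&\begin{matrix}1\\ \vdots\\ x^{k-1}\end{matrix}\\ \hline \begin{matrix}(\mathring\Pi_L^\top)_{k,0}&\cdots&(\mathring\Pi_L^\top)_{k,k-1}\end{matrix}&x^k\end{array}\right],$$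 $$(\check h_L)_k=-\Theta_*\left[\begin{array}{c|c}\mathring\Pi_L^{[k]}&\begin{matrix}(\mathring\Pi_L)_{0,k}\\ \vdots\\ (\mathring\Pi_L)_{k-1,k}\end{matrix}\\ \hline \begin{matrix}(\mathring\Pi_L)_{k,0}&\cdots&(\mathring\Pi_L)_{k,k-1}\end{matrix}&(\mathring\Pi_L)_{k,k}\end{array}\right].$$
   Context: Semi-infinite matrices and vectors are indexed from $0$; $A^{[k]}$ is the leading $k\times k$ truncation (first $k$ entries for a vector). A measure matrix of order $\mathcal N$ is a semi-infinite matrix $\mathcal W=(d\mu_{i,j})$ of Borel measures on sets $\Omega_{i,j}\subseteq\mathbb R$, vanishing outside the block $0\le i,j\le\mathcal N$; $\Omega=\bigcup\Omega_{i,j}$; $(f,h;\mathcal W)=\sum_{n,r}\int_{\Omega_{n,r}}f^{(n)}h^{(r)}d\mu_{n,r}$ (finite on polynomials); $(G_{\mathcal W})_{n,p}=(x^n,x^p;\mathcal W)$. A matrix $G$ is $LU$-factorizable if $\det G^{[k]}\neq0$ for all $k\ge1$; then $G=S_1^{-1}H(S_2^{-1})^\top$ with $S_1,S_2$ lower unitriangular, $H=\mathrm{diag}(h_0,h_1,\dots)$; $P_\alpha(x)=S_\alpha\chi(x)$, $\alpha=1,2$, $\chi(x)=(1,x,x^2,\dots)^\top$, with $k$-th entry $(P_\alpha)_k$. Second kind functions: $(C_1)_l(y)=((P_1)_l(x),\tfrac1{y-x};\mathcal W)$, $(C_2)_l(y)=(\tfrac1{y-x},(P_2)_l(x);\mathcal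 W)$, $y\notin\Omega$ (where $x\mapsto\tfrac1{y-x}$ is assumed to lie in the function space on which the bilinear form is defined). Kernels: $K^{[l]}(x,y)=\sum_{k<l}(P_2)_k(x)h_k^{-1}(P_1)_k(y)$, $\mathcal K_1^{[l]}(x,y)=\sum_{k<l}(C_2)_k(x)h_k^{-1}(P_1)_k(y)$, $\mathcal K_2^{[l]}(x,y)=\sum_{k<l}(P_2)_k(x)h_k^{-1}(C_1)_k(y)$. $\Theta_*\left[\begin{array}{c|c}A&B\\ \hline C&D\end{array}\right]:=D-CA^{-1}B$ (equal to $D$ if $A$ is empty). $\mathcal X$ is the semi-infinite upper bidiagonal matrix with $\mathcal X_{n,n}=x$, $\mathcal X_{n,n+1}=n+1$; $Q(\mathcal X)$ is upper triangular with $Q(\mathcal X)_{n,n+i}=\binom{n+i}{i}Q^{(i)}(x)$. Geronimus–Sobolev deformations: $\check{\mathcal W}_L:=[Q(\mathcal X)]^{-1}\mathcal W+\sum_{i=1}^s\xi^{(i)}\delta(x-q_i)dx$, $\check{\mathcal W}_R:=\mathcal W[Q(\mathcal X^\top)]^{-1}+\sum_{i=1}^s\xi^{(i)}\delta(x-q_i)dx$, on $\Omega\cup\{q_i\}_i$, where $\xi^{(i)}$ is the $n_i\times n_i$ matrix with entries $\xi^{(i)}_{a,b}/(a!\,b!)$, $0\le a,b\le n_i-1$ (placed in rows and columns $0,\dots,n_i-1$), the $\xi^{(i)}_{a,b}$ being free parameters; $\mathring\xi^{(i)}:=(\xi^{(i)}_{a,b})_{a,b}$. Objects associated with $\check{\mathcal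 W}_L$ (resp. $\check{\mathcal W}_R$) are $\check P_{\alpha L},\check h_L$ (resp. $\check P_{\alpha R},\check h_R$). Vector of germs at the zeros of $Q$: $\Pi_q[f]:=\big(\tfrac{f(q_1)}{0!},\dots,\tfrac{f^{(n_1-1)}(q_1)}{(n_1-1)!};\dots;\tfrac{f(q_s)}{0!},\dots,\tfrac{f^{(n_s-1)}(q_s)}{(n_s-1)!}\big)$; applied to a column of functions it gives a matrix row by row; a dot marks the variable on which $\Pi_q$ acts. Let $Q_i(x):=Q(x)/(x-q_i)^{n_i}$, $\eta_{n\times n}$ the $n\times n$ matrix with ones on the anti-diagonal and zeros elsewhere, and $T_j$ the $n_j\times n_j$ upper triangular Toeplitz matrix with $(T_j)_{a,b}=Q_j^{(b-a)}(q_j)/(b-a)!$ for $b\ge a$. Then $\Xi_R=\mathrm{diag}(\Xi_{R1},\dots,\Xi_{Rs})$, $\Xi_{Rj}=\mathring\xi^{(j)}\eta_{n_j\times n_j}T_j$, and $\Xi_L=\mathrm{diag}(\Xi_{L1},\dots,\Xi_{Ls})$, $\Xi_{Lj}=(\mathring\xi^{(j)})^\top\eta_{n_j\times n_j}T_j$. The matrix $\mathbf Q$ has entries $\mathbf Q_{i,j}=Q_{i+j+1}$ ($i,j\ge0$), where $Q_l$ is the coefficient of $x^l$ in $Q(x)$, $Q_N=1$, $Q_l=0$ for $l>N$.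
   Formalization: For k≥N the printed formulas for (P̌_2R)_k/(ȟ_R)_k and (P̌_1L)_k/(ȟ_L)_k are false; they are proved with denominator −h_{k−N} instead of (ȟ_R)_k, (ȟ_L)_k. The sets Ω_{i,j} are taken closed (supports), so that the germs at q_i exist. *)

(* Defs.v *)
From HB Require Import structures.
From mathcomp Require Import all_boot all_order all_algebra.
From mathcomp Require Import all_classical all_reals all_analysis.

Set Implicit Arguments.
Unset Strict Implicit.
Unset Printing Implicit Defensive.

Import Order.TTheory GRing.Theory Num.Theory.
Import numFieldNormedType.Exports.

Local Open Scope classical_set_scope.
Local Open Scope ring_scope.

(** * Signed Borel measures on the line *)

(* Geronimus deformations of positive measures are in general only signed, so
   the entries of a measure matrix are charges (finite signed Borel measures).
   Finiteness is no restriction: all moments, hence the total mass, have to be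
   finite anyway. *)
Notation borel_charge R := ({charge set (measurableTypeR R) -> \bar R}).

Section SignedMeasures.
Variable R : realType.
Implicit Type mu : borel_charge R.

Definition hahnP mu := cid (Hahn_decomposition mu).
Definition hahnN mu := cid (projT2 (hahnP mu)).

(* The Jordan decomposition does not depend on the chosen Hahn decomposition. *)
Definition cpos mu : {finite_measure set (measurableTypeR R) -> \bar R} :=
  jordan_pos (projT2 (hahnN mu)).
Definition cneg mu : {finite_measure set (measurableTypeR R) -> \bar R} :=
  jordan_neg (projT2 (hahnN mu)).

Definition cintegrable mu (D : set R) (f : R -> R) : Prop :=
  (cpos mu).-integrable D (EFin \o f) /\ (cneg mu).-integrable D (EFin \o f).

Definition cintegral mu (D : set R) (f : R -> R) : R :=
  Rintegral (cpos mu) D f - Rintegral (cneg mu) D f.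

(* The signed measure [A |-> \int_(A `&` D) f dmu], set to the zero charge when
   [f] is not [mu]-integrable on [D]. *)
Definition cdensity (f : R -> R) mu (D : set R) : borel_charge R :=
  match pselect ((cpos mu).-integrable setT ((EFin \o f) \_ D)),
        pselect ((cneg mu).-integrable setT ((EFin \o f) \_ D)) with
  | left fp, left fn => cadd (induced_charge fp) (cscale (-1) (induced_charge fn))
  | _, _ => czero
  end.

Definition cdirac (a : R) : borel_charge R :=
  charge_of_finite_measure
    (dirac (a : measurableTypeR R) :
       {finite_measure set (measurableTypeR R) -> \bar R}).

Definition caddC (mu nu : borel_charge R) : borel_charge R := cadd mu nu.
Definition czeroC : borel_charge R := czero.
Definition cscaleC (c : R) mu : borel_charge R := cscale c mu.

End SignedMeasures.

(** * Measure matrices and their Sobolev bilinear forms *)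

Record measure_matrix (R : realType) := MeasureMatrix {
  mm_order : nat;
  mm_entry : nat -> nat -> borel_charge R;
  mm_supp : nat -> nat -> set R }.

Section MeasureMatrices.
Variable R : realType.
Implicit Type W : measure_matrix R.

(* The sets [mm_supp W i j] are closed, like supports: a function defined off
   their union then has germs at every point outside of it. *)
Definition is_measure_matrix W : Prop :=
  [/\ forall i j, closed (mm_supp W i j),
      forall i j (A : set (measurableTypeR R)), measurable A ->
        A `<=` ~` mm_supp W i j -> mm_entry W i j A = 0%E,
      forall i j, ~~ ((i <= mm_order W)%N && (j <= mm_order W)%N) ->
        forall A : set (measurableTypeR R), measurable A ->
          mm_entry W i j A = 0%E
    & forall i j l,
        cintegrable (mm_entry W i j) (mm_supp W i j) (fun x => x ^+ l)].

Definition mm_Omega W : set R :=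
  [set x | exists i j, [/\ (i <= mm_order W)%N, (j <= mm_order W)%N
                         & mm_supp W i j x]].

Definition sform W (f h : R -> R) : R :=
  \sum_(i < (mm_order W).+1) \sum_(j < (mm_order W).+1)
    cintegral (mm_entry W i j) (mm_supp W i j)
      (fun x => derive1n i f x * derive1n j h x).

Definition gram W (i j : nat) : R :=
  sform W (fun x => x ^+ i) (fun x => x ^+ j).

End MeasureMatrices.

(** * LU factorization and biorthogonal polynomials *)

Definition trunc (T : Type) (k : nat) (G : nat -> nat -> T) : 'M[T]_k :=
  \matrix_(i < k, j < k) G i j.

Definition strans (T : Type) (G : nat -> nat -> T) : nat -> nat -> T :=
  fun i j => G j i.

Section LU.
Variable R : realType.
Implicit Type G : nat -> nat -> R.

Definition LU_factorizable G : Prop :=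
  forall k, (0 < k)%N -> \det (trunc k G) != 0.

Definition lower_unitriangular (S : nat -> nat -> R) : Prop :=
  (forall i, S i i = 1) /\ (forall i j, (i < j)%N -> S i j = 0).

Record lu_data := LUData {
  lu_S1 : nat -> nat -> R;
  lu_h : nat -> R;
  lu_S2 : nat -> nat -> R }.

(* [G = S1^-1 H (S2^-1)^T].  As [S1] and [S2] are lower triangular, leading
   truncation commutes with the inverses and with the products here, so the
   semi-infinite identity amounts to its finite truncations. *)
Definition LU_factorization G (F : lu_data) : Prop :=
  [/\ lower_unitriangular (lu_S1 F), lower_unitriangular (lu_S2 F)
    & forall k, trunc k G =
        invmx (trunc k (lu_S1 F)) *m diag_mx (\row_(i < k) lu_h F i)
          *m (invmx (trunc k (lu_S2 F)))^T].

(* The [k]-th entry of [S chi(x)], for [S] lower triangular. *)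
Definition row_poly (S : nat -> nat -> R) (k : nat) : {poly R} :=
  \poly_(j < k.+1) S k j.

Definition poly1 (F : lu_data) (k : nat) : {poly R} := row_poly (lu_S1 F) k.
Definition poly2 (F : lu_data) (k : nat) : {poly R} := row_poly (lu_S2 F) k.

Variables (W : measure_matrix R) (F : lu_data).

Definition second_kind1 (l : nat) (y : R) : R :=
  sform W (fun x => (poly1 F l).[x]) (fun x => (y - x)^-1).
Definition second_kind2 (l : nat) (y : R) : R :=
  sform W (fun x => (y - x)^-1) (fun x => (poly2 F l).[x]).

Definition kernelK (l : nat) (x y : R) : R :=
  \sum_(k < l) (poly2 F k).[x] * (lu_h F k)^-1 * (poly1 F k).[y].
Definition mixed_kernel1 (l : nat) (x y : R) : R :=
  \sum_(k < l) second_kind2 k x * (lu_h F k)^-1 * (poly1 F k).[y].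
Definition mixed_kernel2 (l : nat) (x y : R) : R :=
  \sum_(k < l) (poly2 F k).[x] * (lu_h F k)^-1 * second_kind1 k y.

End LU.

(* The last quasideterminant [D - C A^-1 B]. *)
Definition Theta_star (R : realType) (m : nat)
    (A : 'M[R]_m) (B : 'cV[R]_m) (C : 'rV[R]_m) (D : R) : R :=
  D - (C *m invmx A *m B) 0 0.

(** * Geronimus deformations *)

Section Deformation.
Variables (R : realType) (s : nat) (n : 'I_s -> nat) (q : 'I_s -> R).
(* Only the entries [xi i a b] with [a, b < n i] are used. *)
Variable xi : 'I_s -> nat -> nat -> R.

Definition Qpoly : {poly R} := \prod_(i < s) ('X - (q i)%:P) ^+ n i.

Definition Xmat (x : R) (i j : nat) : R :=
  if j == i then x else if j == i.+1 then i.+1%:R else 0.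

(* Entry [(i, j)] of [Q(M)^-1] for a semi-infinite triangular matrix [M]:
   leading truncation is then multiplicative, so that a truncation of [M]
   containing the entry is enough. *)
Definition Qinv (M : nat -> nat -> R) (i j : nat) : R :=
  invmx (horner_mx (trunc (maxn i j).+1 M) Qpoly) (inord i) (inord j).

Definition mass (i j : nat) : borel_charge R :=
  \big[@caddC R/@czeroC R]_(k < s | (i < n k)%N && (j < n k)%N)
    cscaleC (xi k i j / (i`!%:R * j`!%:R)) (cdirac (q k)).

Definition deformed_order (W : measure_matrix R) : nat :=
  maxn (mm_order W) (\max_(k < s) (n k).-1).

Definition deformed_supp (W : measure_matrix R) (_ _ : nat) : set R :=
  mm_Omega W `|` range q.

Definition geronimusL (W : measure_matrix R) : measure_matrix R :=
  MeasureMatrix (deformed_order W)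
    (fun i j => caddC
       (\big[@caddC R/@czeroC R]_(m < (mm_order W).+1)
          cdensity (fun x => Qinv (Xmat x) i m)
                   (mm_entry W m j) (mm_supp W m j))
       (mass i j))
    (deformed_supp W).

Definition geronimusR (W : measure_matrix R) : measure_matrix R :=
  MeasureMatrix (deformed_order W)
    (fun i j => caddC
       (\big[@caddC R/@czeroC R]_(m < (mm_order W).+1)
          cdensity (fun x => Qinv (strans (Xmat x)) m j)
                   (mm_entry W i m) (mm_supp W i m))
       (mass i j))
    (deformed_supp W).

Local Notation N := (\sum_(i < s) n i)%N.

Definition germs (f : R -> R) : 'rV[R]_N :=
  \mxrow_(i < s) (\row_(a < n i) (derive1n a f (q i) / a`!%:R)).

Definition Tmat (j : 'I_s) : 'M[R]_(n j) :=
  \matrix_(a, b)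
    if (a <= b)%N then
      (derivn (b - a) (Qpoly %/ ('X - (q j)%:P) ^+ n j)).[q j] / (b - a)`!%:R
    else 0.

Definition anti_id (m : nat) : 'M[R]_m := \matrix_(a, b) (a + b == m.-1)%N%:R.

Definition XiR : 'M[R]_N :=
  \mxdiag_(j < s) (trunc (n j) (xi j) *m anti_id (n j) *m Tmat j).
Definition XiL : 'M[R]_N :=
  \mxdiag_(j < s) ((trunc (n j) (xi j))^T *m anti_id (n j) *m Tmat j).

Definition Qmat : 'M[R]_N := trunc N (fun i j => Qpoly`_(i + j).+1).
Definition chi_row (x : R) : 'rV[R]_N := \row_(i < N) x ^+ i.
Definition germs_chi : 'M[R]_N := \matrix_(i < N) germs (fun x => x ^+ i).

Variables (W : measure_matrix R) (F : lu_data R).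

Definition PhiR (l : nat) : 'rV[R]_N :=
  germs (second_kind1 W F l) - germs (fun x => (poly1 F l).[x]) *m XiR.
Definition PhiL (l : nat) : 'rV[R]_N :=
  germs (second_kind2 W F l) - germs (fun x => (poly2 F l).[x]) *m XiL.

(* The rows are numbered [l, ..., l + N - 1]. *)
Definition PhiR_block (l : nat) : 'M[R]_N := \matrix_(i < N) PhiR (l + i).
Definition PhiL_block (l : nat) : 'M[R]_N := \matrix_(i < N) PhiL (l + i).

Definition PiR : 'M[R]_N := PhiR_block 0 *m invmx (Qmat *m germs_chi).
Definition PiL : 'M[R]_N := PhiL_block 0 *m invmx (Qmat *m germs_chi).

Definition kernel_rowR (k : nat) (x : R) : 'rV[R]_N :=
  Qpoly.[x] *: (germs (fun y => mixed_kernel2 W F k x y)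
                - germs (fun y => kernelK F k x y) *m XiR)
  + chi_row x *m Qmat *m germs_chi.
Definition kernel_rowL (k : nat) (x : R) : 'rV[R]_N :=
  Qpoly.[x] *: (germs (fun y => mixed_kernel1 W F k y x)
                - germs (fun y => kernelK F k y x) *m XiL)
  + chi_row x *m Qmat *m germs_chi.

End Deformation.

(* Main.v *)
From HB Require Import structures.
Require Import Defs.
From mathcomp Require Import all_boot all_order all_algebra.
From mathcomp Require Import all_classical all_reals all_analysis.
From mathcomp Require Import measurable_realfun ring lra zify.

(** Write [B] for the bilinear form on polynomials given by the Gram matrix of the
    right deformation and [B0] for the form of [W]. Two facts about [B] carry the
    whole proof.

    First, [B f (Q * h) = B0 f h] ([bil_geronimusR_Q]). Indeed [Q(X^T)^-1] maps the
    derivatives of [h] to those of [h / Q], because [X^T] maps the derivatives of a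
    function to those of its product with the variable. So [B f h] is the pairing of
    [f] with [h / Q] for [W] plus the contribution of the masses ([bil_geronimusR]),
    and the masses do not see the multiples of [Q].

    Second, the vector [Phi] of a polynomial [f] lists, up to sign, the pairings
    [B f (Q / (X - q_i)^(b+1))], [b < n_i], that is the pairings of [f] with a basis
    of the polynomials of degree less than [N] ([PhiR_defect]). The function of the
    second kind contributes because the derivatives of [1 / (y - x)] with respect to
    [y] at [q_i] are, up to sign and factorials, the fractions [1 / (x - q_i)^(b+1)],
    and the matrix [XiR] contributes the masses. The coefficients of the basis
    polynomials are the columns of [Qmat *m germs_chi], by synthetic division
    ([Qmat_germs_chiE]).

    The rest is linear algebra. In the expansion of the deformed polynomial [P1' k]
    in the original [P1 j] the coefficient of [P1 j] is [B (P1' k) (Q * P2 j) / h j],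
    which vanishes for [j + N < k] and is [h' k / h (k - N)] for [j = k - N]. For
    [k >= N] the remaining coefficients are determined by the vanishing of the [Phi]
    of [P1' k]; this gives [P1' k] and its norm. The kernel row is built so that its
    entries are orthogonal for [B] to all degrees less than [k]; its product with the
    first column of the inverse of the block pairs with [P1' l] to [h' k / h (k - N)]
    if [l = k] and to [0] otherwise, so it is [P2' k / h (k - N)] ([kernel_poly_pairing]).
    For [k < N] the matrix [PiR] is minus the matrix of the pairings of [P1 i] with
    the monomials, and the formulas are Gaussian elimination. The left deformation is
    the transpose of the right deformation of the transposed data. *)

Set Implicit Arguments.
Unset Strict Implicit.
Unset Printing Implicit Defensive.

Import Order.TTheory GRing.Theory Num.Theory.
Import numFieldNormedType.Exports.

Local Open Scope classical_set_scope.
Local Open Scope ring_scope.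

(** * Biorthogonal polynomials of a Gram matrix *)

Section BilinearForm.
Variables (R : realType) (G : nat -> nat -> R).
Implicit Types f g : {poly R}.

(** The bilinear form on polynomials whose Gram matrix in the monomials is [G]. *)
Definition bil f g : R :=
  \sum_(i < size f) \sum_(j < size g) f`_i * G i j * g`_j.

Lemma bilE (a b : nat) f g : (size f <= a)%N -> (size g <= b)%N ->
  bil f g = \sum_(i < a) \sum_(j < b) f`_i * G i j * g`_j.
Proof.
move=> fa gb; rewrite /bil (big_ord_widen _ (fun i => \sum_(j < size g) f`_i * G i j * g`_j) fa).
rewrite big_mkcond /=; apply: eq_bigr => i _; case: ltnP => [_|fi]; last first.
  by rewrite big1 // => j _; rewrite nth_default ?mul0r.
rewrite (big_ord_widen _ (fun j => f`_i * G i j * g`_j) gb) big_mkcond /=.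
by apply: eq_bigr => j _; case: ltnP => // gj; rewrite [g`_j]nth_default ?mulr0.
Qed.

Lemma bil_linearl a f1 f2 g : bil (a *: f1 + f2) g = a * bil f1 g + bil f2 g.
Proof.
pose m := maxn (size (a *: f1 + f2)) (maxn (size f1) (size f2)).
have [h0 h1 h2] : [/\ size (a *: f1 + f2)%R <= m, size f1 <= m & size f2 <= m]%N.
  by rewrite /m !leq_max !leqnn !orbT.
rewrite !(@bilE m (size g)) // mulr_sumr -big_split; apply: eq_bigr => i _ /=.
rewrite mulr_sumr -big_split; apply: eq_bigr => j _ /=.
by rewrite coefD coefZ !mulrDl !mulrA.
Qed.

Lemma bil_linearr a f g1 g2 : bil f (a *: g1 + g2) = a * bil f g1 + bil f g2.
Proof.
pose m := maxn (size (a *: g1 + g2)) (maxn (size g1) (size g2)).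
have [h0 h1 h2] : [/\ size (a *: g1 + g2)%R <= m, size g1 <= m & size g2 <= m]%N.
  by rewrite /m !leq_max !leqnn !orbT.
rewrite !(@bilE (size f) m) // mulr_sumr -big_split; apply: eq_bigr => i _ /=.
rewrite mulr_sumr -big_split; apply: eq_bigr => j _ /=.
by rewrite coefD coefZ !mulrDr mulrCA.
Qed.

Lemma bil0l g : bil 0 g = 0.
Proof. by rewrite /bil size_poly0 big_ord0. Qed.

Lemma bil0r f : bil f 0 = 0.
Proof. by rewrite /bil big1 // => i _; rewrite size_poly0 big_ord0. Qed.

Lemma bil_suml (I : Type) (r : seq I) (c : I -> R) (f : I -> {poly R}) g :
  bil (\sum_(i <- r) c i *: f i) g = \sum_(i <- r) c i * bil (f i) g.
Proof.
elim: r => [|i r IH]; first by rewrite !big_nil bil0l.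
by rewrite !big_cons bil_linearl IH.
Qed.

Lemma bil_sumr (I : Type) (r : seq I) (c : I -> R) f (g : I -> {poly R}) :
  bil f (\sum_(i <- r) c i *: g i) = \sum_(i <- r) c i * bil f (g i).
Proof.
elim: r => [|i r IH]; first by rewrite !big_nil bil0r.
by rewrite !big_cons bil_linearr IH.
Qed.

Lemma bilDl f1 f2 g : bil (f1 + f2) g = bil f1 g + bil f2 g.
Proof. by rewrite -[f1]scale1r bil_linearl mul1r scale1r. Qed.

Lemma bilDr f g1 g2 : bil f (g1 + g2) = bil f g1 + bil f g2.
Proof. by rewrite -[g1]scale1r bil_linearr mul1r scale1r. Qed.

Lemma bilBr f g1 g2 : bil f (g1 - g2) = bil f g1 - bil f g2.
Proof. by rewrite addrC -scaleN1r bil_linearr mulN1r addrC. Qed.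

Lemma bilZr a f g : bil f (a *: g) = a * bil f g.
Proof. by rewrite -[a *: g]addr0 bil_linearr bil0r addr0. Qed.

Lemma bil_expandr k f g : (size g <= k)%N ->
  bil f g = \sum_(m < k) g`_m * bil f 'X^m.
Proof.
move=> gk; rewrite -bil_sumr; congr bil; apply/polyP=> i.
rewrite coef_sum; under eq_bigr do rewrite coefZ coefXn.
have [ik|ki] := ltnP i k.
  rewrite (bigD1 (Ordinal ik)) //= eqxx mulr1 big1 ?addr0 // => j ji.
  by rewrite [i == _]eq_sym (negbTE (_ : (j : nat) != i)) ?mulr0 //;
     apply: contra ji => /eqP ?; apply/eqP/val_inj.
rewrite nth_default ?(leq_trans gk) // big1 // => j _.
by rewrite gtn_eqF ?mulr0 // (leq_trans (ltn_ord j)).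
Qed.

End BilinearForm.

Lemma bil_strans (R : realType) (G : nat -> nat -> R) f g :
  bil (strans G) f g = bil G g f.
Proof.
rewrite /bil exchange_big; apply: eq_bigr => j _; apply: eq_bigr => i _ /=.
by rewrite /strans mulrAC [f`_i * _]mulrC mulrAC.
Qed.

(** The transpose of a factorization [G = S1^-1 H S2^-T] factorizes [G^T]:
    it carries every statement about the first family to the second. *)
Definition lu_trans (R : realType) (F : lu_data R) : lu_data R :=
  LUData (lu_S2 F) (lu_h F) (lu_S1 F).

Lemma trunc_strans (R : realType) k (G : nat -> nat -> R) :
  trunc k (strans G) = (trunc k G)^T.
Proof. by apply/matrixP => i j; rewrite !mxE. Qed.

Lemma LU_factorizable_strans (R : realType) (G : nat -> nat -> R) :
  LU_factorizable G -> LU_factorizable (strans G).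
Proof. by move=> fG k k0; rewrite trunc_strans det_tr fG. Qed.

Lemma LU_factorization_strans (R : realType) (G : nat -> nat -> R) F :
  LU_factorization G F -> LU_factorization (strans G) (lu_trans F).
Proof.
move=> [u1 u2 e]; split=> // k.
by rewrite trunc_strans e !trmx_mul tr_diag_mx trmxK mulmxA.
Qed.

Section MonicFamily.
Variables (R : realType) (p : nat -> {poly R}).
Hypothesis p_size : forall k, size (p k) = k.+1.
Hypothesis p_lead : forall k, (p k)`_k = 1.

Lemma monic_family_span k (f : {poly R}) : (size f <= k)%N ->
  exists c : nat -> R, f = \sum_(j < k) c j *: p j.
Proof.
elim: k f => [|k IH] f fk.
  by exists (fun=> 0); rewrite big_ord0; apply/eqP; rewrite -size_poly_leq0.
have /IH [c Hc] : (size (f - f`_k *: p k)%R <= k)%N.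
  apply/leq_sizeP => j; rewrite leq_eqVlt => /predU1P[<-|kj].
    by rewrite coefB coefZ p_lead mulr1 subrr.
  rewrite coefB coefZ (@nth_default _ _ f) ?(leq_trans fk) //.
  by rewrite (@nth_default _ _ (p k)) ?p_size // mulr0 subr0.
exists (fun j => if j == k then f`_k else c j).
rewrite big_ord_recr /= eqxx -[LHS](subrK (f`_k *: p k)) Hc; congr (_ + _).
by apply: eq_bigr => j _; rewrite ltn_eqF.
Qed.

End MonicFamily.

Section RowPoly.
Variables (R : realType) (S : nat -> nat -> R).
Hypothesis uS : lower_unitriangular S.

Lemma coef_row_poly k i : (row_poly S k)`_i = S k i.
Proof.
by case: uS => _ tS; rewrite coef_poly ltnS; case: leqP => // /tS ->.
Qed.

Lemma row_poly_lead k : (row_poly S k)`_k = 1.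
Proof. by case: uS => dS _; rewrite coef_row_poly. Qed.

Lemma size_row_poly k : size (row_poly S k) = k.+1.
Proof.
apply/eqP; rewrite eqn_leq size_poly ltnNge; apply/negP => sk.
by have /eqP := row_poly_lead k; rewrite nth_default // eq_sym oner_eq0.
Qed.

Lemma trunc_unitriangular_unit k : trunc k S \in unitmx.
Proof.
case: uS => dS tS; rewrite unitmxE det_trig.
  by rewrite big1 ?unitr1 // => i _; rewrite mxE.
by apply/is_trig_mxP => i j ij; rewrite mxE tS.
Qed.

End RowPoly.

Section Biorthogonality.
Variables (R : realType) (G : nat -> nat -> R) (F : lu_data R).
Hypotheses (facG : LU_factorizable G) (fG : LU_factorization G F).
Local Notation h := (lu_h F).
Local Notation P1 := (poly1 F).
Local Notation P2 := (poly2 F).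

Lemma size_biorth1 k : size (P1 k) = k.+1.
Proof. by case: fG => u1 _ _; exact: size_row_poly. Qed.

Lemma size_biorth2 k : size (P2 k) = k.+1.
Proof. by case: fG => _ u2 _; exact: size_row_poly. Qed.

Lemma poly1_lead k : (P1 k)`_k = 1.
Proof. by case: fG => u1 _ _; exact: row_poly_lead. Qed.

Lemma poly2_lead k : (P2 k)`_k = 1.
Proof. by case: fG => _ u2 _; exact: row_poly_lead. Qed.

Lemma biorthogonal k l : bil G (P1 k) (P2 l) = if k == l then h k else 0.
Proof.
case: fG => u1 u2 eG; pose m := (maxn k l).+1.
have km : (k < m)%N by rewrite ltnS leq_maxl.
have lm : (l < m)%N by rewrite ltnS leq_maxr.
rewrite (@bilE _ _ m m) ?size_biorth1 ?size_biorth2 //.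
have [U1 U2] := (trunc_unitriangular_unit u1 m, trunc_unitriangular_unit u2 m).
have : trunc m (lu_S1 F) *m trunc m G *m (trunc m (lu_S2 F))^T
       = diag_mx (\row_(i < m) h i).
  by rewrite eG !mulmxA mulmxV // mul1mx -mulmxA -trmx_mul mulmxV // trmx1 mulmx1.
move/matrixP/(_ (Ordinal km) (Ordinal lm)); rewrite !mxE => E.
transitivity (h k *+ (k == l)); last by case: (k == l).
rewrite -[in RHS](inj_eq val_inj) /= in E *; rewrite -E exchange_big.
apply: eq_bigr => j _; rewrite !mxE mulr_suml; apply: eq_bigr => i _.
by rewrite !mxE /poly1 /poly2 !coef_row_poly.
Qed.

Lemma lu_h_neq0 k : h k != 0.
Proof.
case: fG => _ _ eG; have := facG (ltn0Sn k); rewrite eG !det_mulmx.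
rewrite !mulf_eq0 !negb_or => /andP[/andP[_ dH] _]; move: dH; rewrite det_diag.
by move/prodf_neq0/(_ ord_max isT); rewrite mxE.
Qed.

Lemma poly1_orthogonal_lead k (g : {poly R}) : (size g <= k.+1)%N ->
  bil G (P1 k) g = h k * g`_k.
Proof.
move=> gk; have [c ->] := monic_family_span size_biorth2 poly2_lead gk.
rewrite bil_sumr big_ord_recr /= biorthogonal eqxx big1 ?add0r; last first.
  by move=> j _; rewrite biorthogonal gtn_eqF ?mulr0.
rewrite coef_sum big_ord_recr /= big1 ?add0r ?coefZ ?poly2_lead ?mulr1 1?mulrC //.
by move=> j _; rewrite coefZ nth_default ?mulr0 // size_biorth2.
Qed.

Lemma poly1_orthogonal k (g : {poly R}) : (size g <= k)%N -> bil G (P1 k) g = 0.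
Proof.
by move=> gk; rewrite poly1_orthogonal_lead ?nth_default ?mulr0 // leqW.
Qed.

Lemma poly1_expansion k (f : {poly R}) : (size f <= k)%N ->
  f = \sum_(j < k) (bil G f (P2 j) / h j) *: P1 j.
Proof.
move=> fk; have [c ef] := monic_family_span size_biorth1 poly1_lead fk.
rewrite {1}ef; apply: eq_bigr => j _; congr (_ *: _).
rewrite ef bil_suml (bigD1 j) //= biorthogonal eqxx big1 ?addr0 ?mulfK ?lu_h_neq0 //.
by move=> i ij; rewrite biorthogonal (negbTE (_ : (i : nat) != j)) ?mulr0.
Qed.

(** The vanishing pairings include those with [P2 j], [j < k], which are the
    coordinates of [f] up to the factors [h j]. *)
Lemma bil_eq0_left k (f : {poly R}) : (size f <= k)%N ->
  (forall m, (m < k)%N -> bil G f 'X^m = 0) -> f = 0.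
Proof.
move=> fk f0; rewrite (poly1_expansion fk) big1 // => j _.
rewrite (@bil_expandr _ _ k) ?size_biorth2 // big1 ?mul0r ?scale0r // => m _.
by rewrite f0 ?mulr0.
Qed.

Lemma bil_eq0_right k (g : {poly R}) : (size g <= k)%N ->
  (forall j, (j < k)%N -> bil G (P1 j) g = 0) -> g = 0.
Proof.
move=> gk g0; have [c eg] := monic_family_span size_biorth2 poly2_lead gk.
rewrite eg big1 // => j _; suff -> : c j = 0 by rewrite scale0r.
have /eqP := g0 j (ltn_ord j); rewrite eg bil_sumr (bigD1 j) //= biorthogonal eqxx.
rewrite big1 ?addr0 => [|i ij].
  by rewrite mulf_eq0 (negbTE (lu_h_neq0 j)) orbF => /eqP.
by rewrite biorthogonal eq_sym (negbTE (_ : (i : nat) != j)) ?mulr0.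
Qed.

End Biorthogonality.

Lemma poly2_orthogonal (R : realType) (G : nat -> nat -> R) F k (f : {poly R}) :
  LU_factorization G F -> (size f <= k)%N -> bil G f (poly2 F k) = 0.
Proof.
move=> /LU_factorization_strans fG fk; rewrite -bil_strans.
exact: (poly1_orthogonal fG fk).
Qed.

(** * Christoffel-type formulas for a polynomial deformation *)

Lemma row_mxsum (R : realType) m n (u : 'rV[R]_m) (v : 'I_m -> 'rV[R]_n) :
  u *m (\matrix_(i < m) v i) = \sum_(i < m) u 0 i *: v i.
Proof. by rewrite mulmx_sum_row; apply: eq_bigr => i _; rewrite rowK. Qed.

Lemma Theta_star_row (R : realType) m (A : 'M[R]_m) (B : 'cV[R]_m) (w C : 'rV[R]_m) D :
  A \in unitmx -> w *m A = - C -> Theta_star A B C D = D + (w *m B) 0 0.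
Proof.
move=> uA wA; have -> : C = - (w *m A) by rewrite wA opprK.
by rewrite /Theta_star !mulNmx mulmxK // mxE opprK.
Qed.

Section Deformation.
Variables (R : realType) (G G' : nat -> nat -> R) (F F' : lu_data R).
Hypotheses (facG : LU_factorizable G) (facG' : LU_factorizable G').
Hypotheses (luG : LU_factorization G F) (luG' : LU_factorization G' F').
Variables (Q : {poly R}) (N : nat) (E : 'M[R]_N).
Hypotheses (Q_size : size Q = N.+1) (Q_monic : Q \is monic) (E_unit : E \in unitmx).
Hypothesis bilQ : forall f g : {poly R}, bil G' f (Q * g) = bil G f g.

Local Notation h := (lu_h F).
Local Notation h' := (lu_h F').
Local Notation P1 := (poly1 F).
Local Notation P2 := (poly2 F).
Local Notation P1' := (poly1 F').
Local Notation P2' := (poly2 F').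

(** Minus the pairings of [f] with the polynomials whose coefficients are the
    columns of [E]. Its vanishing means orthogonality to all degrees below [N]. *)
Definition defect (f : {poly R}) : 'rV[R]_N :=
  - ((\row_(m < N) bil G' f 'X^m) *m E).

Lemma defect_sum (I : Type) (r : seq I) (c : I -> R) (p : I -> {poly R}) :
  defect (\sum_(j <- r) c j *: p j) = \sum_(j <- r) c j *: defect (p j).
Proof.
rewrite /defect; under [RHS]eq_bigr do rewrite scalerN scalemxAl.
rewrite sumrN -mulmx_suml; congr (- (_ *m _)); apply/rowP => m.
by rewrite !mxE bil_suml summxE; apply: eq_bigr => j _; rewrite !mxE.
Qed.

Lemma defect_eq0 f : (forall m, (m < N)%N -> bil G' f 'X^m = 0) -> defect f = 0.
Proof.
move=> f0; rewrite /defect (_ : \row__ _ = 0) ?mul0mx ?oppr0 //.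
by apply/rowP => m; rewrite !mxE f0.
Qed.

Lemma defect_eq0P f : defect f = 0 -> forall m, (m < N)%N -> bil G' f 'X^m = 0.
Proof.
move/eqP; rewrite oppr_eq0 => /eqP f0 m mN.
have /rowP/(_ (Ordinal mN)) : \row_(m < N) bil G' f 'X^m = 0.
  by rewrite -[LHS](mulmxK E_unit) f0 mul0mx.
by rewrite !mxE.
Qed.

Lemma size_Qmul (g : {poly R}) : g != 0 -> size (Q * g) = (N + size g)%N.
Proof.
by move=> g0; rewrite size_mul // ?(monic_neq0 Q_monic) // Q_size.
Qed.

(** Coefficients of the deformed polynomials in the original ones. *)
Definition connection k j : R := bil G (P1' k) (P2 j) / h j.
Local Notation om := connection.

Lemma connection_expansion k : P1' k = \sum_(j < k.+1) om k j *: P1 j.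
Proof. by apply: poly1_expansion => //; rewrite (size_biorth1 luG'). Qed.

Lemma connection_diag k : om k k = 1.
Proof.
have := poly1_lead luG' k; rewrite connection_expansion coef_sum.
rewrite big_ord_recr /= coefZ (poly1_lead luG) mulr1 big1 ?add0r // => j _.
by rewrite coefZ nth_default ?mulr0 // (size_biorth1 luG).
Qed.

(** The pairing of [P1' k] with [P2 j] for the original form is its pairing with
    [Q * P2 j], of degree [j + N], for the deformed one. *)
Lemma connection_eq0 k j : (j + N < k)%N -> om k j = 0.
Proof.
move=> jk; rewrite /om -bilQ (poly1_orthogonal luG') ?mul0r //.
by rewrite size_Qmul -?size_poly_gt0 (size_biorth2 luG) // addnS addnC.
Qed.

Lemma connection_last k : (N <= k)%N -> om k (k - N) = h' k / h (k - N)%N.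
Proof.
move=> Nk; have s2 : size (Q * P2 (k - N)) = k.+1.
  by rewrite size_Qmul -?size_poly_gt0 (size_biorth2 luG) // addnS subnKC.
rewrite /om -bilQ (poly1_orthogonal_lead luG') ?s2 //.
suff -> : (Q * P2 (k - N))`_k = 1 by rewrite mulr1.
have <- : lead_coef (Q * P2 (k - N)) = (Q * P2 (k - N))`_k by rewrite /lead_coef s2.
rewrite lead_coefM (monicP Q_monic) mul1r /lead_coef.
by rewrite (size_biorth2 luG) (poly2_lead luG).
Qed.

(** Turns the sums over [j < k] of banded families into sums over the [N] rows of
    the block [Phi]. *)
Lemma band_sum (V : zmodType) k (t : nat -> V) : (N <= k)%N ->
    (forall j, (j + N < k)%N -> t j = 0) ->
  \sum_(j < k) t j = \sum_(i < N) t (k - N + i)%N.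
Proof.
move=> Nk t0; rewrite -(big_mkord xpredT t) (@big_cat_nat _ _ _ (k - N)) ?leq_subr //=.
rewrite big_nat big1 ?add0r => [|j /andP[_ jk]]; last by rewrite t0 // addnC -ltn_subRL.
rewrite -{1}[(k - N)%N]add0n big_addn subKn // big_mkord.
by apply: eq_bigr => i _; rewrite addnC.
Qed.

Section AboveDegree.
Variable k : nat.
Hypothesis Nk : (N <= k)%N.
Let Phi := \matrix_(i < N) defect (P1 (k - N + i)).
Let om_row : 'rV[R]_N := \row_(i < N) om k (k - N + i).

Lemma om_row_Phi : om_row *m Phi = - defect (P1 k).
Proof.
have : defect (P1' k) = 0.
  apply: defect_eq0 => m mN; apply: (poly1_orthogonal luG').
  by rewrite size_polyXn (leq_trans mN).
rewrite connection_expansion defect_sum big_ord_recr /= connection_diag scale1r.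
move/eqP; rewrite addr_eq0 => /eqP <-; rewrite row_mxsum.
rewrite (@band_sum _ k (fun j => om k j *: defect (P1 j))) //.
  by apply: eq_bigr => i _; rewrite mxE.
by move=> j /connection_eq0 ->; rewrite scale0r.
Qed.

(** A combination of [P1 (k-N), ..., P1 (k-1)] annihilated by [defect] pairs to
    zero with degrees below [N], and with the multiples of [Q] of degree below
    [k] because it is orthogonal to degrees below [k - N] for the undeformed
    form: it vanishes. *)
Lemma Phi_unit : Phi \in unitmx.
Proof.
rewrite -row_free_unit; apply/inj_row_free => u uPhi.
(* [c] is only read in the window [k - N <= j < k], where [insub] succeeds. *)
pose c j := if insub (j - (k - N))%N is Some i then u 0 i else 0.
have cE (i : 'I_N) : c (k - N + i)%N = u 0 i.
  by rewrite /c addKn insubT // => lt; congr (u 0 _); apply/val_inj.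
pose d j := if (k - N <= j)%N then c j else 0.
have d0 j : (j + N < k)%N -> d j = 0.
  by move=> jk; rewrite /d leqNgt ltn_subRL addnC jk.
have dE (i : 'I_N) : d (k - N + i)%N = u 0 i by rewrite /d leq_addr cE.
pose f : {poly R} := \sum_(j < k) d j *: P1 j.
have f_band : f = \sum_(i < N) u 0 i *: P1 (k - N + i).
  rewrite /f (@band_sum _ k (fun j => d j *: P1 j)) //.
    by apply: eq_bigr => i _; rewrite dE.
  by move=> j /d0 ->; rewrite scale0r.
have f_def : defect f = 0.
  rewrite /f defect_sum -[RHS]uPhi row_mxsum.
  rewrite (@band_sum _ k (fun j => d j *: defect (P1 j))) //.
    by apply: eq_bigr => i _; rewrite dE.
  by move=> j /d0 ->; rewrite scale0r.
have f_size : (size f <= k)%N.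
  apply: (leq_trans (size_sum _ _ _)); apply/bigmax_leqP => j _.
  by rewrite (leq_trans (size_scale_leq _ _)) // (size_biorth1 luG).
have f_Q (g : {poly R}) : (size g + N <= k)%N -> bil G f g = 0.
  move=> gk; rewrite /f bil_suml big1 // => j _.
  have [/d0 ->|kj] := ltnP (j + N) k; first by rewrite mul0r.
  by rewrite (poly1_orthogonal luG) ?mulr0 // -(leq_add2r N) (leq_trans gk).
have f0 : f = 0.
  apply: (bil_eq0_left facG' luG' f_size) => m mk.
  (* Euclidean division by [Q] splits [X^m] into the two kinds of test functions. *)
  rewrite (divp_eq 'X^m Q) bilDr [_ * Q]mulrC bilQ f_Q ?add0r; last first.
    rewrite size_divp ?monic_neq0 // size_polyXn Q_size /=.
    have [mN|Nm] := ltnP m N; last by rewrite subSn // addSn subnK.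
    by rewrite (eqP (_ : m.+1 - N == 0)%N) ?add0n // subn_eq0.
  rewrite (@bil_expandr _ _ N); last by rewrite -ltnS -Q_size ltn_modp monic_neq0.
  by rewrite big1 // => i _; rewrite defect_eq0P ?mulr0.
apply/rowP => i; have ik : (k - N + i < k)%N by rewrite -{2}(subnK Nk) ltn_add2l.
have := bil0l G (P2 (k - N + i)); rewrite -f0 /f bil_suml.
rewrite (bigD1 (Ordinal ik)) //= dE (biorthogonal luG) eqxx big1 ?addr0.
  by move/eqP; rewrite mulf_eq0 (negbTE (lu_h_neq0 facG luG _)) orbF mxE => /eqP.
by move=> j ji; rewrite (biorthogonal luG) (negbTE (_ : (j : nat) != _)) ?mulr0.
Qed.

Lemma deformed_poly1_Theta x :
  (P1' k).[x] = Theta_star Phi (\col_(i < N) (P1 (k - N + i)).[x]) (defect (P1 k)) (P1 k).[x].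
Proof.
rewrite (Theta_star_row _ _ Phi_unit om_row_Phi) connection_expansion horner_sum.
rewrite big_ord_recr /= connection_diag scale1r addrC; congr (_ + _).
rewrite (@band_sum _ k (fun j => (om k j *: P1 j).[x])) //.
  by rewrite mxE; apply: eq_bigr => i _; rewrite !mxE hornerZ.
by move=> j /connection_eq0 ->; rewrite scale0r horner0.
Qed.

Hypothesis N_gt0 : (0 < N)%N.
Let e0 : 'cV[R]_N := \col_(i < N) (i == 0%N :> nat)%:R.

Lemma mulmx_e0 (u : 'rV[R]_N) : (u *m e0) 0 0 = u 0 (Ordinal N_gt0).
Proof.
rewrite mxE (bigD1 (Ordinal N_gt0)) //= mxE eqxx mulr1 big1 ?addr0 // => i i0.
by rewrite mxE (negbTE (_ : (i : nat) != 0%N)) ?mulr0.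
Qed.

Lemma deformed_norm_Theta : h' k = h (k - N)%N * Theta_star Phi e0 (defect (P1 k)) 0.
Proof.
rewrite (Theta_star_row _ _ Phi_unit om_row_Phi) add0r mulmx_e0 mxE addn0.
by rewrite connection_last // mulrC divfK // (lu_h_neq0 facG).
Qed.

(** The kernel row has to be paired with the [P1' l], so its entries are taken as
    polynomials, not as functions of [x]. *)
Definition kernel_poly (b : 'I_N) : {poly R} :=
  Q * \sum_(j < k) (defect (P1 j) 0 b / h j) *: P2 j + \sum_(m < N) E m b *: 'X^m.

(** The first term reproduces the defect of the part of [f] of degree less than
    [k], and the second subtracts the defect of [f]. *)
Lemma bil_kernel_poly f b : bil G' f (kernel_poly b) =
  \sum_(j < k) bil G f (P2 j) / h j * defect (P1 j) 0 b - defect f 0 b.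
Proof.
rewrite /kernel_poly bilDr bilQ !bil_sumr; congr (_ + _).
  by apply: eq_bigr => j _; rewrite mulrC mulrA mulrAC.
by rewrite !mxE opprK; apply: eq_bigr => m _; rewrite mxE mulrC.
Qed.

(** For [l < k] the right-hand side of [bil_kernel_poly] vanishes by
    completeness; for [l >= k] it is a combination of the rows of [Phi], whose
    first coefficient is zero unless [l = k]. *)
Lemma kernel_poly_pairing l :
  \sum_b (invmx Phi *m e0) b 0 * bil G' (P1' l) (kernel_poly b)
  = if l == k then h' k / h (k - N)%N else 0.
Proof.
pose v := \row_b bil G' (P1' l) (kernel_poly b).
have vE : v = \sum_(j < k) om l j *: defect (P1 j) - defect (P1' l).
  apply/rowP => b; rewrite [LHS]mxE [RHS]mxE summxE bil_kernel_poly.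
  rewrite [X in _ = _ + X]mxE; congr (_ - _).
  by apply: eq_bigr => j _; rewrite [RHS]mxE.
transitivity ((v *m invmx Phi *m e0) 0 0).
  by rewrite -mulmxA mxE; apply: eq_bigr => b _; rewrite [v 0 b]mxE mulrC.
have [lk|kl] := ltnP l k.
  rewrite ltn_eqF // vE connection_expansion defect_sum.
  rewrite (big_ord_widen _ (fun j => om l j *: defect (P1 j)) lk) [in X in _ - X]big_mkcond /=.
  rewrite (_ : _ - _ = 0) ?mul0mx ?mxE //; apply/eqP; rewrite subr_eq0; apply/eqP.
  apply: eq_bigr => j _; case: ltnP => // lj.
  by rewrite /om (poly2_orthogonal luG) ?mul0r ?scale0r // (size_biorth1 luG').
have -> : v = (\row_(i < N) om l (k - N + i)) *m Phi.
  rewrite vE (@defect_eq0 (P1' l)) ?subr0 => [|m mN]; last first.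
    by rewrite (poly1_orthogonal luG') ?size_polyXn // (leq_trans mN) // (leq_trans Nk).
  rewrite row_mxsum (@band_sum _ k (fun j => om l j *: defect (P1 j))) //.
    by apply: eq_bigr => i _; rewrite mxE.
  by move=> j jk; rewrite connection_eq0 ?scale0r // (leq_trans jk).
rewrite mulmxK ?Phi_unit // mulmx_e0 mxE addn0; case: eqP => [->|/eqP lk].
  by rewrite connection_last.
by rewrite connection_eq0 // subnK // ltn_neqAle eq_sym lk.
Qed.

(** Both sides have the same pairings with every [P1' l]. *)
Lemma deformed_poly2_kernel :
  (h (k - N)%N)^-1 *: P2' k = \sum_b (invmx Phi *m e0) b 0 *: kernel_poly b.
Proof.
apply/eqP; rewrite -subr_eq0; apply/eqP.
set g := _ - _; apply: (bil_eq0_right facG' luG' (leqnn (size g))) => l _.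
rewrite bilBr bilZr (biorthogonal luG') bil_sumr kernel_poly_pairing.
by case: eqP => [->|_]; rewrite ?mulr0 ?subr0 // mulrC subrr.
Qed.

Lemma deformed_poly2_Theta x (K : 'rV[R]_N) :
    K = \row_b (kernel_poly b).[x] ->
  (P2' k).[x] / - h (k - N)%N = Theta_star Phi e0 K 0.
Proof.
move=> ->; rewrite /Theta_star sub0r invrN mulrN mulrC -hornerZ deformed_poly2_kernel.
rewrite -mulmxA mxE horner_sum; congr (- _); apply: eq_bigr => b _.
by rewrite hornerZ [X in _ = X * _]mxE mulrC.
Qed.

End AboveDegree.

Section BelowDegree.
Variable k : 'I_N.
Let w : 'I_k -> 'I_N := widen_ord (ltnW (ltn_ord k)).
Let M := (\matrix_(i < N) defect (P1 i)) *m invmx E.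
Let om_row : 'rV[R]_k := \row_(j < k) om k j.

(** Below degree [N] the matrix of the theorem is minus the matrix of moments of
    the deformed form, in the basis [P1 i] on the left. *)
Lemma low_momentE i m : M i m = - bil G' (P1 i) 'X^m.
Proof.
rewrite /M (_ : \matrix_(i < N) _ = - (\matrix_(i < N, m < N) bil G' (P1 i) 'X^m *m E)).
  by rewrite mulNmx mulmxK // !mxE.
apply/row_matrixP => a; rewrite rowK linearN /= row_mul.
by congr (- (_ *m _)); apply/rowP => b; rewrite !mxE.
Qed.

Lemma low_moment_unit : mxsub w w M \in unitmx.
Proof.
rewrite -row_free_unit; apply/inj_row_free => u uM.
pose f := \sum_(j < k) u 0 j *: P1 j.
have f_size : (size f <= k)%N.
  apply: (leq_trans (size_sum _ _ _)); apply/bigmax_leqP => j _.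
  by rewrite (leq_trans (size_scale_leq _ _)) // (size_biorth1 luG).
have f0 : f = 0.
  apply: (bil_eq0_left facG' luG' f_size) => m mk.
  apply/eqP; rewrite bil_suml -oppr_eq0 -sumrN; apply/eqP.
  have E0 : (u *m mxsub w w M) 0 (Ordinal mk) = 0 by rewrite uM mxE.
  apply: etrans E0; rewrite [RHS]mxE; apply: eq_bigr => j _.
  by rewrite [mxsub _ _ _ _ _]mxE low_momentE mulrN.
apply/rowP => i; have := bil0l G (P2 i); rewrite -f0 /f bil_suml.
rewrite (bigD1 i) //= (biorthogonal luG) eqxx big1 ?addr0.
  by move/eqP; rewrite mulf_eq0 (negbTE (lu_h_neq0 facG luG _)) orbF mxE => /eqP.
by move=> j ji; rewrite (biorthogonal luG) (negbTE (_ : (j : nat) != _)) ?mulr0.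
Qed.

Lemma bil_deformed1_low (m : 'I_N) :
  bil G' (P1' k) 'X^m = - (M k m + \sum_(j < k) om k j * M (w j) m).
Proof.
rewrite connection_expansion big_ord_recr /= connection_diag scale1r bilDl addrC.
rewrite bil_suml opprD low_momentE opprK -sumrN; congr (_ + _).
by apply: eq_bigr => j _; rewrite low_momentE mulrN opprK.
Qed.

Lemma om_row_low : om_row *m mxsub w w M = - \row_(j < k) M k (w j).
Proof.
apply/rowP => m; have /eqP := bil_deformed1_low (w m).
rewrite (poly1_orthogonal luG'); last by rewrite size_polyXn; exact: (ltn_ord m).
rewrite eq_sym oppr_eq0 addrC addr_eq0 => /eqP E0.
rewrite mxE [RHS]mxE [X in _ = - X]mxE -E0; apply: eq_bigr => j _.
by rewrite [om_row _ _]mxE [mxsub _ _ _ _ _]mxE.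
Qed.

Lemma deformed_poly1_low x :
  (P1' k).[x] = Theta_star (mxsub w w M) (\col_(i < k) (P1 i).[x])
                  (\row_(j < k) M k (w j)) (P1 k).[x].
Proof.
rewrite (Theta_star_row _ _ low_moment_unit om_row_low) connection_expansion.
rewrite horner_sum big_ord_recr /= connection_diag scale1r addrC; congr (_ + _).
by rewrite mxE; apply: eq_bigr => i _; rewrite !mxE hornerZ.
Qed.

Lemma deformed_norm_low :
  h' k = - Theta_star (mxsub w w M) (\col_(i < k) M (w i) k)
             (\row_(j < k) M k (w j)) (M k k).
Proof.
rewrite (Theta_star_row _ _ low_moment_unit om_row_low).
have := bil_deformed1_low k.
rewrite (poly1_orthogonal_lead luG') ?size_polyXn // coefXn eqxx mulr1 => ->.
by rewrite [X in _ = - (_ + X)]mxE; congr (- (_ + _)); apply: eq_bigr => j _;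
   rewrite [om_row _ _]mxE [(\col_(i < k) M (w i) k) _ _]mxE.
Qed.

Lemma deformed_poly2_low x :
  (P2' k).[x] = Theta_star (mxsub w w M^T) (\col_(i < k) x ^+ i)
                  (\row_(j < k) M^T k (w j)) (x ^+ k).
Proof.
have uT : mxsub w w M^T \in unitmx by rewrite -trmx_mxsub unitmx_tr low_moment_unit.
have s2 := size_biorth2 luG' k.
rewrite (@Theta_star_row _ _ _ _ (\row_(j < k) (P2' k)`_j) _ _ uT).
  rewrite horner_coef s2 big_ord_recr /= (poly2_lead luG') mul1r addrC.
  by congr (_ + _); rewrite mxE; apply: eq_bigr => i _; rewrite !mxE.
apply/rowP => j; apply/eqP; rewrite mxE [X in _ == X]mxE [X in _ == - X]mxE [M^T _ _]mxE.
rewrite -addr_eq0 -oppr_eq0.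
have O : bil G' (P1 j) (P2' k) = 0.
  by rewrite (poly2_orthogonal luG') // (size_biorth1 luG) (ltn_ord j).
apply/eqP; apply: etrans O.
rewrite (@bil_expandr _ _ k.+1) ?s2 // big_ord_recr /= (poly2_lead luG') mul1r.
rewrite opprD low_momentE opprK -sumrN; congr (_ + _).
apply: eq_bigr => m _; rewrite [(\row__ _) _ _]mxE [mxsub _ _ _ _ _]mxE [M^T _ _]mxE.
by rewrite low_momentE mulrN opprK.
Qed.

End BelowDegree.
End Deformation.

(** * Taylor coefficients and the matrix of the zeros of the deforming polynomial *)

Section Taylor.
Variable R : realType.
Implicit Types (p r : {poly R}) (a : R).

(** Composition with [X + a] is a ring morphism: the Leibniz rule and the order
    of vanishing at [a] are read off the coefficients. *)
Definition tcoef (b : nat) a p : R := (p \Po ('X + a%:P))`_b.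

Lemma tcoef_nderivn b a p : tcoef b a p = p^`N(b).[a].
Proof.
have := @nderiv_taylor _ (map_poly polyC p) a%:P 'X (mulrC _ _).
rewrite -/(comp_poly _ _) addrC => E.
rewrite /tcoef E; under eq_bigr do rewrite nderivn_map horner_map mul_polyC.
rewrite coef_sumMXn /= size_map_polyC; have [bp|pb] := ltnP b (size p).
  by rewrite (big_pred1 (Ordinal bp)).
rewrite nderivn_poly0 // horner0 big1 // => i /eqP ib.
by have := ltn_ord i; rewrite ib ltnNge pb.
Qed.

Lemma derivn_tcoef b a p : p^`(b).[a] = tcoef b a p * b`!%:R.
Proof. by rewrite tcoef_nderivn nderivn_def hornerMn -mulr_natr. Qed.

Lemma derive1n_horner b p : derive1n b (fun x => p.[x]) = (fun x => p^`(b).[x]).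
Proof.
elim: b => [|b IH]; first by [].
by rewrite derive1nS IH derivnS -[RHS]/(horner _) derivE.
Qed.

Lemma tcoef_derive b a p : derive1n b (fun x => p.[x]) a / b`!%:R = tcoef b a p.
Proof.
by rewrite derive1n_horner derivn_tcoef mulfK // pnatr_eq0 -lt0n fact_gt0.
Qed.

Lemma tcoefD b a p r : tcoef b a (p + r) = tcoef b a p + tcoef b a r.
Proof. by rewrite /tcoef comp_polyD coefD. Qed.

Lemma tcoef_sum b a (I : Type) (s : seq I) (c : I -> R) (p : I -> {poly R}) :
  tcoef b a (\sum_(i <- s) c i *: p i) = \sum_(i <- s) c i * tcoef b a (p i).
Proof.
elim: s => [|i s IH]; first by rewrite !big_nil /tcoef comp_poly0 coef0.
by rewrite !big_cons tcoefD IH /tcoef comp_polyZ coefZ.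
Qed.

Lemma tcoef1 b a : tcoef b a 1 = (b == 0)%:R.
Proof. by rewrite /tcoef -[1]/(1%:P) comp_polyC coefC; case: eqP. Qed.

Lemma tcoef_mulX b a p :
  tcoef b a (p * 'X) = (if b is b'.+1 then tcoef b' a p else 0) + a * tcoef b a p.
Proof.
rewrite /tcoef comp_polyM comp_polyX mulrDr coefD coefMX coefMC mulrC.
by case: b => //= b; rewrite mulrC.
Qed.

Lemma tcoef_mul_XsubC_exp b a m p :
  tcoef b a (p * ('X - a%:P) ^+ m) = if (b < m)%N then 0 else tcoef (b - m) a p.
Proof.
rewrite /tcoef comp_polyM rmorphXn /= comp_polyB comp_polyX comp_polyC addrK.
by rewrite coefMXn.
Qed.

Lemma tcoef_dvdp b a m p : ('X - a%:P) ^+ m %| p -> (b < m)%N -> tcoef b a p = 0.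
Proof. by move=> /dvdpP[r ->] bm; rewrite tcoef_mul_XsubC_exp bm. Qed.

Lemma dvdp_tcoef a m p :
  (forall b, (b < m)%N -> tcoef b a p = 0) -> ('X - a%:P) ^+ m %| p.
Proof.
move=> p0; have : 'X^m %| p \Po ('X + a%:P).
  rewrite -[_ \Po _](poly_take_drop m) (_ : take_poly _ _ = 0) ?add0r ?dvdp_mull //.
  by apply/polyP => i; rewrite coef_take_poly coef0; case: ifP => // /p0.
move/(dvdp_comp_poly ('X - a%:P)); rewrite comp_Xn_poly -comp_polyA.
by rewrite comp_polyD comp_polyX comp_polyC subrK comp_polyXr.
Qed.

End Taylor.

Section Zeros.
Variables (R : realType) (s : nat) (n : 'I_s -> nat) (q : 'I_s -> R).
Hypothesis q_inj : injective q.
Local Notation Q := (Qpoly n q).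
Local Notation N := (\sum_(i < s) n i)%N.

Lemma Qpoly_monic : Q \is monic.
Proof. by apply: monic_prod => i _; rewrite monic_exp ?monicXsubC. Qed.

Lemma size_Qpoly : size Q = N.+1.
Proof.
suff /(_ (index_enum _)) [] : forall r : seq 'I_s,
    size (\prod_(i <- r) ('X - (q i)%:P) ^+ n i) = (\sum_(i <- r) n i).+1 by [].
elim => [|i r IH]; first by rewrite !big_nil size_poly1.
rewrite !big_cons size_monicM ?monic_exp ?monicXsubC //.
  by rewrite IH size_exp_XsubC addnS.
by rewrite monic_neq0 // monic_prod // => j _; rewrite monic_exp ?monicXsubC.
Qed.

Lemma Qpoly_lead : Q`_N = 1.
Proof. by rewrite -[N]/(N.+1.-1) -size_Qpoly -lead_coefE (monicP Qpoly_monic). Qed.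

Definition Qcofactor i : {poly R} := \prod_(j < s | j != i) ('X - (q j)%:P) ^+ n j.

Lemma Qpoly_split i : Q = Qcofactor i * ('X - (q i)%:P) ^+ n i.
Proof. by rewrite /Qpoly (bigD1 i) //= mulrC. Qed.

Lemma Qcofactor_divp i : Q %/ ('X - (q i)%:P) ^+ n i = Qcofactor i.
Proof. by rewrite (Qpoly_split i) mulpK // monic_neq0 // monic_exp ?monicXsubC. Qed.

Lemma dvdp_Qcofactor i k : k != i -> ('X - (q k)%:P) ^+ n k %| Qcofactor i.
Proof. by move=> ki; rewrite /Qcofactor (bigD1 k) //= dvdp_mulIl. Qed.

(** The factors of [Q] are pairwise coprime because the [q i] are distinct. *)
Lemma Qpoly_dvdp p : (forall i, ('X - (q i)%:P) ^+ n i %| p) -> Q %| p.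
Proof.
move=> dp; rewrite /Qpoly; have := index_enum_uniq 'I_s.
elim: (index_enum _) => [|i r IH] /=; first by rewrite big_nil dvd1p.
case/andP=> ir ur; rewrite big_cons Gauss_dvdp ?dp ?IH //.
rewrite coprimep_expl // coprimep_sym coprimep_XsubC rootE horner_prod.
rewrite prodf_seq_neq0; apply/allP => j jr /=.
rewrite horner_exp hornerXsubC expf_neq0 // subr_eq0.
by apply: contra ir => /eqP/q_inj ->.
Qed.

(** The column [(i, b)] of [Qmat *m germs_chi] lists the coefficients of
    [Q / (X - q_i)^(b+1)]. *)
Definition zero_quotient i (b : nat) : {poly R} :=
  Qcofactor i * ('X - (q i)%:P) ^+ (n i - b.+1).

Lemma zero_quotientE i b : (b < n i)%N ->
  zero_quotient i b * ('X - (q i)%:P) ^+ b.+1 = Q.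
Proof. by move=> bn; rewrite -mulrA -exprD subnK // -Qpoly_split. Qed.

Let synth a b : {poly R} := \sum_(j < N) tcoef b a 'X^j *: drop_poly j.+1 Q.

(** Synthetic division: multiplying by [X - a] lowers [b] by one, because
    [X * drop_poly j.+1 Q = drop_poly j Q - Q_j] and because the Taylor coefficients
    satisfy the rule of Pascal; what remains telescopes. *)
Lemma synth_mul a b : tcoef b a Q = 0 ->
  synth a b * ('X - a%:P) = if b is b'.+1 then synth a b' else Q.
Proof.
move=> Q0; have dropX j : drop_poly j.+1 Q * 'X = drop_poly j Q - (Q`_j)%:P.
  apply/polyP => -[|i]; rewrite coefMX coefB coefC /= !coef_drop_poly ?add0n ?subrr //.
  by rewrite subr0 addSnnS.
have step j : tcoef b a 'X^j *: drop_poly j.+1 Q * ('X - a%:P) =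
    (if b is b'.+1 then tcoef b' a 'X^j *: drop_poly j.+1 Q else 0)
    - (tcoef b a 'X^(j.+1) *: drop_poly j.+1 Q - tcoef b a 'X^j *: drop_poly j Q)
    - (tcoef b a 'X^j * Q`_j)%:P.
  rewrite -scalerAl mulrBr dropX exprSr tcoef_mulX mulrC mul_polyC !scalerBr.
  rewrite scalerA mulrC scalerDl; case: b {Q0} => [|b]; rewrite ?scale0r;
  rewrite -!mul_polyC !polyCM; ring.
rewrite /synth mulr_suml; under eq_bigr do rewrite step.
rewrite !big_split /= sumrN -[X in - X](big_mkord xpredT (fun j =>
  tcoef b a 'X^(j.+1) *: drop_poly j.+1 Q - tcoef b a 'X^j *: drop_poly j Q)).
rewrite telescope_sumr // sumrN -rmorph_sum /=.
have Qe : \sum_(j < N) tcoef b a 'X^j * Q`_j = - tcoef b a 'X^N.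
  have : tcoef b a (\sum_(j < N.+1) Q`_j *: 'X^j) = 0.
    by rewrite -size_Qpoly -poly_def coefK.
  rewrite tcoef_sum big_ord_recr /= Qpoly_lead mul1r => /eqP; rewrite addr_eq0 => /eqP <-.
  by apply: eq_bigr => j _; rewrite mulrC.
rewrite Qe drop_poly0l (_ : drop_poly N Q = 1); last first.
  apply/polyP => i; rewrite coef_drop_poly coef1; case: i => [|i].
    by rewrite add0n Qpoly_lead.
  by rewrite nth_default // size_Qpoly addSn ltnS leq_addl.
rewrite rmorphN /= opprK -mul_polyC mulr1.
rewrite expr0 tcoef1; case: b {Q0 step Qe} => [|b] /=.
  rewrite big1 // add0r scale1r; ring.
rewrite scale0r; ring.
Qed.
Lemma synthE i b : (b < n i)%N -> synth (q i) b = zero_quotient i b.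
Proof.
move=> bn; have Xb0 : ('X - (q i)%:P) ^+ b.+1 != 0 by rewrite expf_neq0 // polyXsubC_eq0.
apply: (mulIf Xb0); rewrite zero_quotientE //; elim: b bn {Xb0} => [|b IH] bn.
  by rewrite expr1 synth_mul // (@tcoef_dvdp _ _ _ (n i)) // (Qpoly_split i) dvdp_mulIr.
rewrite exprS mulrA synth_mul ?IH ?(ltnW bn) //.
by rewrite (@tcoef_dvdp _ _ _ (n i)) // (Qpoly_split i) dvdp_mulIr.
Qed.

Lemma germs_hornerE p : germs n q (fun x => p.[x])
  = \mxrow_(i < s) (\row_(a < n i) tcoef a (q i) p).
Proof.
by apply: eq_mxrow => i; apply/rowP => a; rewrite !mxE tcoef_derive.
Qed.

Lemma germs_chiE : germs_chi n q
  = \mxrow_(i < s) (\matrix_(j < N, a < n i) tcoef a (q i) 'X^j).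
Proof.
apply/row_matrixP => j; rewrite rowK row_mxrow.
have -> : (fun x => x ^+ j) = (fun x : R => 'X^j.[x]).
  by apply/funext => x; rewrite hornerXn.
by rewrite germs_hornerE; apply: eq_mxrow => i; apply/rowP => a; rewrite !mxE.
Qed.

Lemma Qmat_germs_chiE :
  Qmat n q *m germs_chi n q
  = \mxrow_(i < s) (\matrix_(m < N, b < n i) (zero_quotient i b)`_m).
Proof.
rewrite germs_chiE mul_mxrow; apply: eq_mxrow => i; apply/matrixP => m b.
rewrite mxE [RHS]mxE -synthE // coef_sum; apply: eq_bigr => j _.
by rewrite !mxE coefZ coef_drop_poly mulrC addnS.
Qed.

Lemma size_zero_quotient i b : (b < n i)%N -> (size (zero_quotient i b) <= N)%N.
Proof.
move=> bn; rewrite -synthE //; apply: (leq_trans (size_sum _ _ _)).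
apply/bigmax_leqP => j _; apply: (leq_trans (size_scale_leq _ _)).
by rewrite size_drop_poly size_Qpoly subSS leq_subr.
Qed.

Lemma tcoef_zero_quotient_neq i k b c : k != i -> (c < n k)%N ->
  tcoef c (q k) (zero_quotient i b) = 0.
Proof.
move=> ki ck; apply: (tcoef_dvdp _ ck).
by rewrite dvdp_mulr // dvdp_Qcofactor.
Qed.

(** The anti-diagonal matrix reverses the index because [Q / (X - q_i)^(b+1)] has the
    factor [(X - q_i)^(n_i - b - 1)]: its Taylor coefficients are those of the
    cofactor, shifted by [n_i - b - 1]. *)
Lemma tcoef_zero_quotient i (b c : 'I_(n i)) :
  tcoef c (q i) (zero_quotient i b) = (anti_id R (n i) *m Tmat n q i) c b.
Proof.
have c' : (n i - c.+1 < n i)%N by rewrite subnSK // leq_subr.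
rewrite mxE (bigD1 (Ordinal c')) //= big1 ?addr0 => [|d dc]; last first.
  rewrite mxE (_ : (_ == _) = false) ?mul0r //; apply/negbTE.
  apply: contra dc => /eqP cd; apply/eqP/val_inj => /=.
  by have := ltn_ord c; move: cd; lia.
rewrite !mxE /= (_ : (_ == _) = true) ?mul1r; last by have := ltn_ord c; lia.
rewrite tcoef_mul_XsubC_exp Qcofactor_divp.
have -> : (c < n i - b.+1)%N = ~~ (n i - c.+1 <= b)%N.
  by rewrite -ltnNge !ltn_subRL [in RHS]addnC addnS addSn.
case: leqP => //= cb; rewrite nderivn_def hornerMn -tcoef_nderivn -mulr_natr mulfK //.
congr tcoef; have := ltn_ord b; have := ltn_ord c; move: cb.
lia.
Qed.

(** [Qmat] vanishes below its anti-diagonal, where the entries are the leading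
    coefficient [1] of [Q]. *)
Lemma Qmat_unit : Qmat n q \in unitmx.
Proof.
rewrite -row_free_unit; apply/inj_row_free => u uQ.
suff u0 m (mN : (m < N)%N) : u 0 (Ordinal mN) = 0.
  by apply/rowP => m; rewrite mxE -(u0 m (ltn_ord m)); congr (u 0 _); apply/val_inj.
elim/ltn_ind: m mN => m IH mN.
have jN : (N - m.+1 < N)%N by rewrite subnSK // leq_subr.
have : (u *m Qmat n q) 0 (Ordinal jN) = 0 by rewrite uQ mxE.
rewrite mxE (bigD1 (Ordinal mN)) //= [X in _ + X]big1 ?addr0 => [|i im].
  rewrite mxE /= (_ : (_ + _).+1 = N) ?Qpoly_lead ?mulr1 //.
  by rewrite -addnS subnSK // subnKC // ltnW.
rewrite mxE /=; have [lt|] := ltnP i m.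
  by rewrite (_ : i = Ordinal (ltn_ord i)) ?IH ?mul0r //; apply/val_inj.
rewrite leq_eqVlt => /predU1P[mi|mi]; first by case/eqP: im; apply/val_inj.
rewrite nth_default ?mulr0 // size_Qpoly ltnS.
by rewrite -[leqLHS](subnKC mN) leq_add2r.
Qed.

(** A polynomial of degree less than [N] whose germs at the zeros of [Q] vanish is
    divisible by [Q], hence zero. *)
Lemma germs_chi_unit : germs_chi n q \in unitmx.
Proof.
rewrite -row_free_unit; apply/inj_row_free => u; rewrite germs_chiE mul_mxrow.
move=> uE.
have u0 i : u *m \matrix_(j < N, a < n i) tcoef a (q i) 'X^j = 0.
  by move: i; apply/eq_mxrowP; rewrite uE mxrow0.
pose p := \sum_(j < N) u 0 j *: 'X^j.
have /Qpoly_dvdp : forall i, ('X - (q i)%:P) ^+ n i %| p.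
  move=> i; apply: dvdp_tcoef => b bn; rewrite tcoef_sum.
  have E0 : (u *m \matrix_(j < N, a < n i) tcoef a (q i) 'X^j) 0 (Ordinal bn) = 0.
    by rewrite u0 mxE.
  by apply: etrans E0; rewrite [RHS]mxE; apply: eq_bigr => j _; rewrite [in RHS]mxE.
have sp : (size p <= N)%N.
  apply: (leq_trans (size_sum _ _ _)); apply/bigmax_leqP => j _.
  by apply: (leq_trans (size_scale_leq _ _)); rewrite size_polyXn.
have [p0 _|pn0] := eqVneq p 0; last first.
  by move/(dvdp_leq pn0); rewrite size_Qpoly ltnNge sp.
apply/rowP => j; rewrite mxE; have := congr1 (fun r : {poly R} => r`_j) p0.
rewrite coef0 coef_sum (bigD1 j) //= coefZ coefXn eqxx mulr1 [X in _ + X]big1 ?addr0 // => i ij.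
by rewrite coefZ coefXn eq_sym (negbTE (_ : (i : nat) != j)) ?mulr0.
Qed.

Lemma Qmat_germs_chi_unit : Qmat n q *m germs_chi n q \in unitmx.
Proof. by rewrite unitmx_mul Qmat_unit germs_chi_unit. Qed.

End Zeros.

(** * Integration against signed measures *)

Section Density.
Context d (T : measurableType d) (R : realType).
Variables (m : {finite_measure set T -> \bar R}) (k : T -> R).
Hypotheses (k_ge0 : forall x, 0 <= k x) (ik : m.-integrable [set: T] (EFin \o k)).

Let induced_ge0 A : (0 <= induced_charge ik A)%E.
Proof. by apply: integral_ge0 => x _; rewrite lee_fin. Qed.

Definition density : set T -> \bar R := measure_of_charge (induced_charge ik) induced_ge0.

HB.instance Definition _ := Measure.on density.

Lemma densityE A : density A = (\int[m]_(x in A) (k x)%:E)%E.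
Proof. by []. Qed.

Lemma density_fin : fin_num_fun density.
Proof.
move=> A mA; apply: integrable_fin_num => //.
exact: (integrableS measurableT).
Qed.

HB.instance Definition _ := @Measure_isFinite.Build _ _ _ density density_fin.

Let mk D : measurable_fun D (EFin \o k).
Proof. by apply: measurable_funTS; exact: (measurable_int m). Qed.

Lemma density_dominated : density `<< m.
Proof.
apply/null_content_dominatesP => A mA mA0; rewrite densityE.
by apply: null_set_integral => //; exact: mk.
Qed.

Let RN_density : ae_eq m [set: T] (Radon_Nikodym_SigmaFinite.f density m) (EFin \o k).
Proof.
apply: integral_ae_eq => //.
- exact: Radon_Nikodym_SigmaFinite.f_integrable density_dominated.
- move=> A _ mA.
  by rewrite -(Radon_Nikodym_SigmaFinite.f_integral density_dominated mA).
Qed.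

(** By uniqueness the Radon-Nikodym derivative is [k], and integration against a
    dominated measure is integration against its derivative. *)
Lemma ge0_integral_density (D : set T) (f : T -> \bar R) : measurable D ->
  (forall x, 0 <= f x)%E -> measurable_fun D f ->
  (\int[density]_(x in D) f x = \int[m]_(x in D) (f x * (k x)%:E))%E.
Proof.
move=> mD f0 mf.
rewrite -(Radon_Nikodym_SigmaFinite.change_of_variables density_dominated f0 mD mf).
apply: ae_eq_integral => //.
- apply: emeasurable_funM => //; apply: measurable_funTS; apply: measurable_int.
  exact: Radon_Nikodym_SigmaFinite.f_integrable density_dominated.
- exact: emeasurable_funM.
- by apply: ae_eqe_mul2l; apply: ae_eq_subset RN_density.
Qed.

Lemma integrable_density (D : set T) (f : T -> R) : measurable D ->
  measurable_fun D f -> m.-integrable D (EFin \o (f \* k)) ->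
  density.-integrable D (EFin \o f).
Proof.
move=> mD /measurable_EFinP mf /integrableP[_ fin]; apply/integrableP; split => //.
rewrite ge0_integral_density //; last exact: measurableT_comp.
rewrite (le_lt_trans _ fin) // le_eqVlt; apply/orP; left; apply/eqP.
by apply: eq_integral => x _; rewrite /= normrM (ger0_norm (k_ge0 x)) EFinM.
Qed.

Lemma integral_density (D : set T) (f : T -> R) : measurable D ->
  measurable_fun D f ->
  (\int[density]_(x in D) (f x)%:E = \int[m]_(x in D) (f x * k x)%:E)%E.
Proof.
move=> mD /measurable_EFinP mf; rewrite integralE [RHS]integralE.
rewrite !ge0_integral_density //; first last.
- exact: measurable_funepos.
- exact: measurable_funeneg.
congr (_ - _)%E; apply: eq_integral => x _.
- by rewrite !funeposE -!EFin_max -EFinM maxr_pMl // mul0r.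
- by rewrite !funenegE -!EFinN -!EFin_max -EFinM maxr_pMl // mul0r mulNr.
Qed.
End Density.

(** A signed measure represented as a difference of two finite measures, not
    necessarily the Jordan ones, that integrate [f] on [D] to the difference [v].
    Sums and densities are easy to represent in this way. *)
Definition cint_rep d (T : measurableType d) (R : realType)
    (nu : {charge set T -> \bar R}) (D : set T) (f : T -> R) (v : R) : Prop :=
  exists m1 m2 : {measure set T -> \bar R},
  [/\ fin_num_fun m1 /\ fin_num_fun m2,
      forall A, measurable A -> nu A = (m1 A - m2 A)%E,
      m1.-integrable D (EFin \o f), m2.-integrable D (EFin \o f)
    & v = Rintegral m1 D f - Rintegral m2 D f].

Section Representation.
Context d (T : measurableType d) (R : realType).
Implicit Types (nu : {charge set T -> \bar R}) (D : set T) (f : T -> R).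

Lemma Rintegral_measure_add (m1 m2 : {measure set T -> \bar R}) D f :
  measurable D -> m1.-integrable D (EFin \o f) -> m2.-integrable D (EFin \o f) ->
  Rintegral (measure_add m1 m2) D f = Rintegral m1 D f + Rintegral m2 D f.
Proof.
move=> mD i1 i2; rewrite /Rintegral integral_measure_add //.
by rewrite fineD // integrable_fin_num.
Qed.

Lemma integrable_measure_add (m1 m2 : {measure set T -> \bar R}) D f :
  measurable D -> m1.-integrable D (EFin \o f) -> m2.-integrable D (EFin \o f) ->
  (measure_add m1 m2).-integrable D (EFin \o f).
Proof.
move=> mD /integrableP[mf f1] /integrableP[_ f2]; apply/integrableP; split => //.
rewrite ge0_integral_measure_add //; last exact: measurableT_comp.
exact: lte_add_pinfty.
Qed.

Lemma measure_add_fin (m1 m2 : {measure set T -> \bar R}) :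
  fin_num_fun m1 -> fin_num_fun m2 -> fin_num_fun (measure_add m1 m2).
Proof. by move=> f1 f2 A mA; rewrite measure_addE fin_numD f1 ?f2. Qed.

Lemma cint_rep_add nu1 nu2 D f v1 v2 : measurable D ->
  cint_rep nu1 D f v1 -> cint_rep nu2 D f v2 ->
  cint_rep (cadd nu1 nu2) D f (v1 + v2).
Proof.
move=> mD [a1 [b1 [[fa1 fb1] e1 ia1 ib1 ->]]] [a2 [b2 [[fa2 fb2] e2 ia2 ib2 ->]]].
exists (measure_add a1 a2), (measure_add b1 b2); split.
- by split; exact: measure_add_fin.
- move=> A mA; rewrite [LHS]/(nu1 A + nu2 A)%E e1 // e2 //.
  rewrite [RHS]/(measure_add a1 a2 A - measure_add b1 b2 A)%E !measure_addE.
  by rewrite fin_num_oppeD ?fb2 //; exact: addeACA.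
- exact: integrable_measure_add.
- exact: integrable_measure_add.
- by rewrite !Rintegral_measure_add // opprD addrACA.
Qed.

Lemma cint_rep_opp nu D f v : cint_rep nu D f v ->
  cint_rep (cscale (-1) nu) D f (- v).
Proof.
move=> [a [b [[fa fb] e ia ib ->]]]; exists b, a; split => //; last by rewrite opprB.
move=> A mA; transitivity (- nu A)%E; first exact: (congr1 (@^~ A) (cscaleN1 nu)).
rewrite e //.
by rewrite fin_num_oppeB ?fb // addeC.
Qed.

(** The positive and negative parts of the density give the two measures. *)
Lemma cint_rep_density nu (m : {finite_measure set T -> \bar R}) (k : T -> R) D f :
  measurable D -> measurable_fun D f ->
  m.-integrable [set: T] (EFin \o k) ->
  (forall A, measurable A -> nu A = (\int[m]_(x in A) (k x)%:E)%E) ->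
  m.-integrable D (EFin \o (f \* k)) ->
  cint_rep nu D f (Rintegral m D (fun x => f x * k x)).
Proof.
move=> mD mf ik nuE ifk.
have ip : m.-integrable [set: T] (EFin \o (fun x => Num.max (k x) 0)).
  exact: (integrable_funrpos measurableT ik).
have iq : m.-integrable [set: T] (EFin \o (fun x => Num.max (- k x) 0)).
  exact: (integrable_funrneg measurableT ik).
have p0 x : 0 <= Num.max (k x) 0 by rewrite le_max lexx orbT.
have q0 x : 0 <= Num.max (- k x) 0 by rewrite le_max lexx orbT.
have mk (g : T -> R) : m.-integrable [set: T] (EFin \o g) -> measurable_fun D g.
  by move=> /(measurable_int m)/measurable_EFinP mg; exact: measurable_funTS.
have dom (g : T -> R) : m.-integrable [set: T] (EFin \o g) ->
    (forall x, `|g x| <= `|k x|) -> m.-integrable D (EFin \o (f \* g)).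
  move=> ig gk; apply: le_integrable ifk => //.
    by apply/measurable_EFinP; apply: measurable_funM => //; exact: mk.
  by move=> x _; rewrite /= lee_fin !normrM ler_wpM2l.
have ifp : m.-integrable D (EFin \o (f \* (fun x => Num.max (k x) 0))).
  by apply: dom => // x; rewrite ger0_norm // ge_max normr_ge0 ler_norm.
have ifq : m.-integrable D (EFin \o (f \* (fun x => Num.max (- k x) 0))).
  by apply: dom => // x; rewrite ger0_norm // ge_max normr_ge0 -normrN ler_norm.
exists (density p0 ip), (density q0 iq); split.
- by split; exact: density_fin.
- move=> A mA; rewrite nuE //.
  have := @integralB_EFin _ _ _ m A (fun x => Num.max (k x) 0)
    (fun x => Num.max (- k x) 0) mA => intB; apply: etrans (intB _ _).
  + apply: eq_integral => x _; rewrite -EFinB; congr EFin.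
    by have := congr1 (@^~ x) (funrposBneg k).
  + exact: integrableS ip.
  + exact: integrableS iq.
- exact: integrable_density.
- exact: integrable_density.
- rewrite /Rintegral !integral_density // -/(Rintegral _ _ _) -[X in _ - X]/(Rintegral _ _ _).
  rewrite -RintegralB //; apply: eq_Rintegral => x _; rewrite -mulrBr; congr (_ * _).
  by have := congr1 (@^~ x) (funrposBneg k).
Qed.

(** Whatever the representation, the Jordan parts are smaller and the integrals
    agree: [pos + m2 = neg + m1] as measures. *)
Lemma cint_rep_jordan nu D f v (P N : set T) (H : hahn_decomposition nu P N) :
  measurable D -> measurable_fun [set: T] f -> cint_rep nu D f v ->
  [/\ (jordan_pos H).-integrable D (EFin \o f), (jordan_neg H).-integrable D (EFin \o f)
    & Rintegral (jordan_pos H) D f - Rintegral (jordan_neg H) D f = v].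
Proof.
move=> mD mf [m1 [m2 [[f1 f2] e i1 i2 ->]]].
have [[mP _] [mN _] _ _] := H.
have le1 A : measurable A -> (jordan_pos H A <= m1 A)%E.
  move=> mA; rewrite jordan_posE cjordan_posE /crestr0 mem_set // /crestr.
  have mAP := measurableI _ _ mA mP; rewrite e //.
  apply: (@le_trans _ _ (m1 (A `&` P))); first by rewrite leeBlDr ?f2 // leeDl.
  by apply: le_measure; rewrite ?inE.
have le2 A : measurable A -> (jordan_neg H A <= m2 A)%E.
  move=> mA; rewrite jordan_negE cjordan_negE /crestr0 mem_set // /crestr.
  have mAN := measurableI _ _ mA mN; rewrite e //.
  apply: (@le_trans _ _ (m2 (A `&` N))); last by apply: le_measure; rewrite ?inE.
  by rewrite fin_num_oppeB ?f2 // addeC leeBlDr ?f1 // leeDl.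
have le_int (a b : {measure set T -> \bar R}) : (forall A, measurable A -> a A <= b A)%E ->
    b.-integrable D (EFin \o f) -> a.-integrable D (EFin \o f).
  move=> ab /integrableP[mfD fb]; apply/integrableP; split => //.
  rewrite (le_lt_trans _ fb) // ge0_le_measure_integral //.
  by apply: measurableT_comp => //; exact/measurable_EFinP.
have ip := le_int _ _ le1 i1; have iq := le_int _ _ le2 i2.
suff E : Rintegral (jordan_pos H) D f + Rintegral m2 D f =
    Rintegral m1 D f + Rintegral (jordan_neg H) D f.
  split=> //; rewrite -[X in X - _](addrK (Rintegral m2 D f)) E.
  by rewrite addrAC addrK.
rewrite -!Rintegral_measure_add // /Rintegral.
congr fine; apply: eq_measure_integral => A mA _.
transitivity (jordan_pos H A + m2 A)%E; first exact: measure_addE.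
apply: esym; transitivity (m1 A + jordan_neg H A)%E; first exact: measure_addE.
have pf : jordan_pos H A \is a fin_num by exact: fin_num_measure.
have nf : jordan_neg H A \is a fin_num by exact: fin_num_measure.
have : (jordan_pos H A - jordan_neg H A = m1 A - m2 A)%E.
  rewrite -e // (jordan_decomp H mA); congr (_ + _)%E.
  exact: esym (congr1 (@^~ A) (cscaleN1 _)).
rewrite -(fineK pf) -(fineK nf) -(fineK (f1 _ mA)) -(fineK (f2 _ mA)).
rewrite -!EFinB -!EFinD => -[] E0; congr EFin.
by rewrite -[fine (m1 A)](subrK (fine (m2 A))) -E0 addrAC subrK.
Qed.

Lemma jordan_zero nu (P N : set T) (H : hahn_decomposition nu P N) A :
  (forall B, measurable B -> nu B = 0%E) -> measurable A ->
  jordan_pos H A = 0%E /\ jordan_neg H A = 0%E.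
Proof.
move=> nu0 mA; have [[mP _] [mN _] _ _] := H; split.
  rewrite jordan_posE cjordan_posE /crestr0 mem_set // /crestr nu0 //.
  exact: measurableI.
rewrite jordan_negE cjordan_negE /crestr0 mem_set // /crestr nu0 ?oppe0 //.
exact: measurableI.
Qed.

End Representation.

Section Cintegral.
Variable R : realType.
Local Notation T := (measurableTypeR R).
Implicit Types (mu : borel_charge R) (D : set T) (f : T -> R).

Lemma cint_rep_cintegral mu D f v : measurable D -> measurable_fun [set: T] f ->
  cint_rep mu D f v -> cintegrable mu D f /\ cintegral mu D f = v.
Proof.
move=> mD mf /cint_rep_jordan -/(_ _ _ (projT2 (hahnN mu)) mD mf) [i1 i2 e].
by split.
Qed.
End Cintegral.

(** * Rational functions and the inverse of the matrix [Q(X)] *)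

Section RationalDerivatives.
Variables (R : realType) (V : {poly R}).
Implicit Types (p r : {poly R}) (x : R).

(** The [k]-th derivative of [p / V] is [rat_num k p / V ^ (k + 1)]. *)
Fixpoint rat_num (k : nat) p : {poly R} :=
  if k is k'.+1 then (rat_num k' p)^`() * V - k%:R *: (rat_num k' p * V^`()) else p.

Definition rat_deriv (k : nat) p x : R := (rat_num k p).[x] / V.[x] ^+ k.+1.

Lemma rat_numD k p r : rat_num k (p + r) = rat_num k p + rat_num k r.
Proof.
elim: k => [//|k IH] /=; rewrite IH derivD !mulrDl scalerDr opprD.
by rewrite addrACA.
Qed.

Lemma rat_numZ k c p : rat_num k (c *: p) = c *: rat_num k p.
Proof.
elim: k => [//|k IH] /=; rewrite IH derivZ -!scalerAl scalerBr !scalerA.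
by rewrite [c * _]mulrC.
Qed.

Lemma rat_num_mulX k p :
  rat_num k (p * 'X) = rat_num k p * 'X + k%:R *: (rat_num k.-1 p * V).
Proof.
elim: k => [|k IH]; first by rewrite scale0r addr0.
rewrite /= IH derivD derivM derivX derivZ derivM.
case: k {IH} => [|k] /=; first by rewrite !scale0r !scale1r; ring.
rewrite -!mul_polyC !polyC_natr; ring.
Qed.

Lemma rat_num_mulV k p : rat_num k (V * p) = p^`(k) * V ^+ k.+1.
Proof.
elim: k => [|k IH]; first by rewrite mulrC.
rewrite /= IH derivM deriv_exp /= -mul_polyC polyC_natr -mulr_natr.
rewrite !exprS; ring.
Qed.

Lemma rat_derivD k p r x : rat_deriv k (p + r) x = rat_deriv k p x + rat_deriv k r x.
Proof. by rewrite /rat_deriv rat_numD hornerD mulrDl. Qed.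

Lemma rat_derivZ k c p x : rat_deriv k (c *: p) x = c * rat_deriv k p x.
Proof. by rewrite /rat_deriv rat_numZ hornerZ mulrA. Qed.

Section NonVanishing.
Variable x : R.
Hypothesis Vx : V.[x] != 0.

Lemma rat_deriv_mulX k p :
  rat_deriv k (p * 'X) x = x * rat_deriv k p x + k%:R * rat_deriv k.-1 p x.
Proof.
rewrite /rat_deriv rat_num_mulX !hornerE.
case: k => [|k] /=; first by rewrite expr1; field.
by rewrite [V.[x] ^+ k.+2]exprS; field; rewrite expf_neq0 // Vx.
Qed.

Lemma rat_deriv_mulV k p : rat_deriv k (V * p) x = p^`(k).[x].
Proof. by rewrite /rat_deriv rat_num_mulV hornerM horner_exp mulfK ?expf_neq0. Qed.

Lemma rat_deriv_mul_XsubC k p :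
  rat_deriv k (p * ('X - x%:P)) x = k%:R * rat_deriv k.-1 p x.
Proof.
rewrite mulrBr rat_derivD rat_deriv_mulX -scaleN1r rat_derivZ [p * _]mulrC mul_polyC.
by rewrite rat_derivZ mulN1r addrAC subrr add0r.
Qed.

Lemma rat_deriv_XsubC_exp k j :
  rat_deriv k (('X - x%:P) ^+ j) x = (k ^_ j)%:R * rat_deriv (k - j) 1 x.
Proof.
elim: j k => [|j IH] k; first by rewrite expr0 subn0 ffactn0 mul1r.
rewrite exprSr rat_deriv_mul_XsubC; case: k => [|k]; first by rewrite !mul0r.
by rewrite IH [LHS]mulrA -natrM subSS ffactnS.
Qed.

End NonVanishing.
End RationalDerivatives.

Section InverseQX.
Variables (R : realType) (s : nat) (n : 'I_s -> nat) (q : 'I_s -> R) (x : R).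
Local Notation Q := (Qpoly n q).
Hypothesis Qx : Q.[x] != 0.
Variable k : nat.
Let A : 'M[R]_k.+1 := horner_mx (trunc k.+1 (strans (Xmat x))) Q.
Let rvec p : 'cV[R]_k.+1 := \col_i rat_deriv Q i p x.
Let T : 'M[R]_k.+1 := \matrix_(i, j) ('C(i, j)%:R * rat_deriv Q (i - j) 1 x).

(** [X^T] acts on the vector of derivatives of a function as multiplication by
    the variable (Leibniz), hence [Q(X^T)] acts as multiplication by [Q]. *)
Lemma Xmat_rvec p : trunc k.+1 (strans (Xmat x)) *m rvec p = rvec (p * 'X).
Proof.
apply/colP => i; rewrite !mxE rat_deriv_mulX // (bigD1 i) //= !mxE /strans /Xmat eqxx.
congr (_ + _); case: i => -[|i] ik /=.
  rewrite mul0r big1 // => j j0; rewrite !mxE /strans /Xmat.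
  by rewrite eq_sym (negbTE (_ : (j : nat) != 0%N)) ?mul0r.
rewrite (bigD1 (Ordinal (ltnW ik))) /=; last by rewrite -val_eqE /= ltn_eqF.
rewrite !mxE /strans /Xmat /= gtn_eqF // eqxx big1 ?addr0 // => j /andP[j1 j2].
rewrite !mxE /strans /Xmat /= eq_sym (negbTE (_ : (j : nat) != i.+1)) //.
by rewrite eqSS eq_sym (negbTE (_ : (j : nat) != i)) ?mul0r.
Qed.

Lemma horner_Xmat_rvec g p :
  horner_mx (trunc k.+1 (strans (Xmat x))) g *m rvec p = rvec (g * p).
Proof.
elim/poly_ind: g p => [|g c IH] p.
  rewrite rmorph0 mul0mx mul0r; apply/colP => i; rewrite !mxE.
  by rewrite -[0 in RHS](scale0r 1) rat_derivZ mul0r.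
rewrite rmorphD rmorphM /= horner_mx_X horner_mx_C mulmxDl -mulmxA Xmat_rvec IH.
rewrite mul_scalar_mx mulrDl -mulrA ['X * p]mulrC mul_polyC.
by apply/colP => i; rewrite !mxE rat_derivD rat_derivZ.
Qed.

(** The right-hand columns are the derivatives of [(X - x)^j / (j! Q)] at [x], which
    [A] maps to those of [(X - x)^j / j!], the vectors of the canonical basis. *)
Lemma horner_Xmat_mul_inverse : A *m T = 1%:M.
Proof.
apply/matrixP => i j.
have colT : col j T = (j`!%:R)^-1 *: rvec (('X - x%:P) ^+ j).
  apply/colP => a; rewrite !mxE rat_deriv_XsubC_exp // [RHS]mulrA; congr (_ * _).
  by rewrite -bin_ffact natrM mulrC mulfK // pnatr_eq0 -lt0n fact_gt0.
have -> : (A *m T) i j = (A *m col j T) i 0.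
  by rewrite [LHS]mxE [RHS]mxE; apply: eq_bigr => a _; rewrite [in RHS]mxE.
rewrite colT -scalemxAr mxE horner_Xmat_rvec mxE rat_deriv_mulV // nderivn_def.
rewrite hornerMn -tcoef_nderivn -[_ ^+ j]mul1r tcoef_mul_XsubC_exp mxE.
have [ij|ji|eij] := ltngtP i j.
- by rewrite mul0rn mulr0 -val_eqE /= ltn_eqF.
- rewrite tcoef1 subn_eq0 leqNgt ji mul0rn mulr0 -val_eqE /= gtn_eqF //.
by rewrite eij subnn tcoef1 -val_eqE /= eij eqxx -mulr_natl mulr1 mulVf.
Qed.

Lemma invmx_horner_Xmat : invmx A = T.
Proof.
have [uA _] := mulmx1_unit horner_Xmat_mul_inverse.
by rewrite -[LHS]mulmx1 -horner_Xmat_mul_inverse mulmxA mulVmx // mul1mx.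
Qed.

Lemma rat_deriv_Leibniz p i : (i < k.+1)%N ->
  \sum_(j < k.+1) 'C(i, j)%:R * rat_deriv Q (i - j) 1 x * p^`(j).[x] = rat_deriv Q i p x.
Proof.
move=> ik; have [uA _] := mulmx1_unit horner_Xmat_mul_inverse.
have E : T *m rvec (Q * p) = rvec p.
  by rewrite -horner_Xmat_rvec mulmxA -invmx_horner_Xmat mulVmx // mul1mx.
have := congr1 (fun M : 'cV[R]_k.+1 => M (Ordinal ik) 0) E.
rewrite [X in X = _]mxE [X in _ = X]mxE => <-; apply: eq_bigr => j _.
by rewrite !mxE rat_deriv_mulV.
Qed.

End InverseQX.

Lemma QinvE (R : realType) s (n : 'I_s -> nat) (q : 'I_s -> R) x i j :
  (Qpoly n q).[x] != 0 ->
  Qinv n q (strans (Xmat x)) i j = 'C(i, j)%:R * rat_deriv (Qpoly n q) (i - j) 1 x.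
Proof.
move=> Qx; rewrite /Qinv invmx_horner_Xmat // mxE !inordK // ltnS.
  by rewrite leq_maxr.
by rewrite leq_maxl.
Qed.

(** * Integrals of rational functions against charges with finite moments *)

Section CintegralTheory.
Variable R : realType.
Local Notation T := (measurableTypeR R).
Implicit Types (mu : borel_charge R) (D : set R) (f g : R -> R) (p V : {poly R}).

Lemma closed_measurableT D : closed D -> measurable (D : set T).
Proof. by move=> cD; exact: closed_measurable. Qed.

Lemma measurable_horner D p : measurable_fun (D : set T) (fun x : T => p.[x]).
Proof.
by apply: measurable_funTS; apply: continuous_measurable_fun; exact: continuous_horner.
Qed.

Lemma eq_cintegral mu D f g : {in D, f =1 g} -> cintegral mu D f = cintegral mu D g.
Proof. by move=> fg; rewrite /cintegral; congr (_ - _); exact: eq_Rintegral. Qed.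

Lemma eq_cintegrable mu D f g : measurable (D : set T) -> {in D, f =1 g} ->
  cintegrable mu D f -> cintegrable mu D g.
Proof.
move=> mD fg [i1 i2].
by split; [apply: (eq_integrable mD) i1|apply: (eq_integrable mD) i2] => x xD;
  rewrite /= fg.
Qed.

Section Linearity.
Variables (mu : borel_charge R) (D : set R).
Hypothesis mD : measurable (D : set T).

Lemma cintegrableD f g : cintegrable mu D f -> cintegrable mu D g ->
  cintegrable mu D (fun x => f x + g x).
Proof.
by move=> [f1 f2] [g1 g2]; split; [exact: (integrableD mD f1 g1)|exact: (integrableD mD f2 g2)].
Qed.

Lemma cintegrableZ c f : cintegrable mu D f -> cintegrable mu D (fun x => c * f x).
Proof.
by move=> [f1 f2]; split; [exact: (integrableZl mD c f1)|exact: (integrableZl mD c f2)].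
Qed.

Lemma cintegrable0 : cintegrable mu D (fun=> 0).
Proof. by split; exact: integrable0. Qed.

Lemma cintegrable_sum (I : Type) (r : seq I) (P : pred I) (F : I -> R -> R) :
  (forall i, P i -> cintegrable mu D (F i)) ->
  cintegrable mu D (fun x => \sum_(i <- r | P i) F i x).
Proof.
move=> iF; elim: r => [|i r IH].
  by apply: (eq_cintegrable mD) cintegrable0 => x _; rewrite big_nil.
have [Pi|nPi] := boolP (P i).
  apply: (eq_cintegrable mD) (cintegrableD (iF i Pi) IH) => x _.
  by rewrite big_cons Pi.
by apply: (eq_cintegrable mD) IH => x _; rewrite big_cons (negbTE nPi).
Qed.

Lemma cintegralD f g : cintegrable mu D f -> cintegrable mu D g ->
  cintegral mu D (fun x => f x + g x) = cintegral mu D f + cintegral mu D g.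
Proof.
move=> [f1 f2] [g1 g2]; rewrite /cintegral !RintegralD //.
by rewrite opprD addrACA.
Qed.

Lemma cintegralZ c f : cintegrable mu D f ->
  cintegral mu D (fun x => c * f x) = c * cintegral mu D f.
Proof. by move=> [f1 f2]; rewrite /cintegral !RintegralZl // mulrBr. Qed.

Lemma cintegral0 : cintegral mu D (fun=> 0) = 0.
Proof. by rewrite /cintegral /Rintegral !integral0 /= subrr. Qed.

Lemma cintegral_sum (I : Type) (r : seq I) (P : pred I) (F : I -> R -> R) :
  (forall i, P i -> cintegrable mu D (F i)) ->
  cintegral mu D (fun x => \sum_(i <- r | P i) F i x)
  = \sum_(i <- r | P i) cintegral mu D (F i).
Proof.
move=> iF; elim: r => [|i r IH].
  rewrite big_nil -[RHS]cintegral0.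
  by apply: eq_cintegral => x _; rewrite big_nil.
have iS := cintegrable_sum r iF.
rewrite big_cons; have [Pi|nPi] := boolP (P i).
  rewrite -IH -cintegralD //; last exact: iF.
  by apply: eq_cintegral => x _; rewrite big_cons Pi.
by rewrite -IH; apply: eq_cintegral => x _; rewrite big_cons (negbTE nPi).
Qed.

End Linearity.

Definition finite_moments mu D := forall l, cintegrable mu D (fun x => x ^+ l).

(** A lower bound for the denominator makes a rational function integrable as soon
    as the moments are finite, whatever its growth at infinity. *)
Definition bounded_away D V := exists2 c : R, 0 < c & forall x, D x -> c <= `|V.[x]|.

Lemma bounded_away_neq0 D V x : bounded_away D V -> D x -> V.[x] != 0.
Proof. by move=> [c c0 cV] /cV; rewrite -normr_gt0; exact: lt_le_trans. Qed.

Lemma bounded_awayM D V U : bounded_away D V -> bounded_away D U ->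
  bounded_away D (V * U).
Proof.
move=> [c c0 cV] [e e0 eU]; exists (c * e); first exact: mulr_gt0.
move=> x Dx; rewrite hornerM normrM.
by apply: ler_pM; [exact: ltW|exact: ltW|exact: cV|exact: eU].
Qed.

Lemma bounded_away1 D : bounded_away D 1.
Proof. by exists 1 => // x _; rewrite hornerC normr1. Qed.

Lemma bounded_away_XsubC D a : closed D -> ~ D a -> bounded_away D ('X - a%:P).
Proof.
move=> cD nDa; have : nbhs a (~` D) by exact: open_nbhs_nbhs (conj (closed_openC cD) nDa).
move=> /nbhs_ballP[e /= e0 He]; exists e => // x Dx; rewrite hornerXsubC leNgt.
by apply/negP => xa; apply: (He x) => //; rewrite /ball /= distrC.
Qed.

Lemma bounded_away_prod D (I : finType) (F : I -> {poly R}) :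
  (forall i, bounded_away D (F i)) -> bounded_away D (\prod_i F i).
Proof.
move=> bF; elim/big_ind : _ => [|U V|i _]; [exact: bounded_away1|exact: bounded_awayM|exact: bF].
Qed.

Lemma bounded_awayX D V k : bounded_away D V -> bounded_away D (V ^+ k).
Proof.
move=> bV; elim: k => [|k IH]; first exact: bounded_away1.
by rewrite exprS; exact: bounded_awayM.
Qed.

Section RationalIntegrable.
Variables (mu : borel_charge R) (D : set R).
Hypotheses (cD : closed D) (mom : finite_moments mu D).
Let mD := closed_measurableT cD.

Lemma cintegrable_horner p : cintegrable mu D (fun x => p.[x]).
Proof.
apply: (@eq_cintegrable _ _ (fun x => \sum_(i < size p) p`_i * x ^+ i)) => //.
  by move=> x _; rewrite horner_coef.
by apply: cintegrable_sum => // i _; apply: cintegrableZ.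
Qed.

Lemma measurable_inv_horner V : bounded_away D V ->
  measurable_fun (D : set T) (fun x : T => V.[x]^-1).
Proof.
move=> bV; apply: subspace_continuous_measurable_fun => //.
rewrite continuous_subspace_in => x /set_mem Dx.
apply: cvgV; first exact: (bounded_away_neq0 bV).
apply: (@continuous_subspaceT _ _ _ (horner V)).
exact: continuous_horner.
Qed.

Lemma cintegrable_rat p V : bounded_away D V -> cintegrable mu D (fun x => p.[x] / V.[x]).
Proof.
move=> bV; have [c c0 cV] := bV; have [i1 i2] := cintegrable_horner p.
have bd : [bounded V.[x]^-1 | x in D].
  exists c^-1; split => [|M cM x Dx]; first exact: num_real.
  rewrite /= normfV (le_trans _ (ltW cM)) // lef_pV2 ?cV ?posrE //.
  by rewrite (lt_le_trans c0) ?cV.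
have mV := measurable_inv_horner bV.
by split; [exact: (integrableMl mD i1 mV bd)|exact: (integrableMl mD i2 mV bd)].
Qed.

Lemma cintegrable_horner_rat p r V k : bounded_away D V ->
  cintegrable mu D (fun x => p.[x] * rat_deriv V k r x).
Proof.
move=> bV; apply: (eq_cintegrable mD) (cintegrable_rat (p * rat_num V k r) (bounded_awayX k.+1 bV)).
by move=> x _; rewrite /rat_deriv hornerM horner_exp mulrA.
Qed.

End RationalIntegrable.

(** * Integrals against the deformed charges *)

Lemma cint_rep_zero (nu : borel_charge R) D f : measurable (D : set T) ->
  measurable_fun (D : set T) f ->
  (forall A, measurable (A : set T) -> nu A = 0%E) -> cint_rep nu D f 0.
Proof.
move=> mD mf nu0.
have iz : (@mzero _ T R).-integrable D (EFin \o f).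
  by apply/integrableP; split; [exact/measurable_EFinP|rewrite integral_measure_zero].
exists (@mzero _ T R), (@mzero _ T R); split => //.
- by move=> A mA; rewrite nu0 //= sube0.
- by rewrite subrr.
Qed.

Lemma cint_rep_cdensity mu (D' D : set R) (g f : R -> R) :
  measurable (D' : set T) -> measurable (D : set T) -> D' `<=` D ->
  measurable_fun (D : set T) f ->
  cintegrable mu D' g -> cintegrable mu D' (fun x => f x * g x) ->
  cint_rep (cdensity g mu D') D f (cintegral mu D' (fun x => f x * g x)).
Proof.
move=> mD' mD D'D mf [g1 g2] [fg1 fg2].
have toT (m : {measure set T -> \bar R}) : m.-integrable D' (EFin \o g) ->
    m.-integrable [set: T] (EFin \o (g \_ D')).
  by move=> ig; rewrite -restrict_EFin; exact/(integrable_mkcond _ mD').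
have restr x : f x * (g \_ D') x = ((fun x => f x * g x) \_ D') x.
  by rewrite /patch; case: ifP => // _; rewrite mulr0.
have toD (m : {measure set T -> \bar R}) : m.-integrable D' (EFin \o (fun x => f x * g x)) ->
    m.-integrable D (EFin \o (f \* (g \_ D'))).
  move=> ifg; have : m.-integrable D ((EFin \o (fun x => f x * g x)) \_ D').
    by apply/integrable_restrict => //; rewrite setIidr.
  by apply: eq_integrable => // x _; rewrite restrict_EFin /= restr.
have val (m : {measure set T -> \bar R}) :
    Rintegral m D (fun x => f x * (g \_ D') x) = Rintegral m D' (fun x => f x * g x).
  rewrite -[in RHS](setIidr D'D) Rintegral_mkcondr.
  by apply: eq_Rintegral => x _; exact: restr.
rewrite /cdensity; case: pselect => [fp|[]]; last first.
  rewrite restrict_EFin. apply: toT.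
  exact g1.
case: pselect => [fn|[]]; last by rewrite restrict_EFin; apply: toT.
rewrite /cintegral -!val; apply: cint_rep_add => //.
  apply: cint_rep_density => //; [exact: toT| |exact: toD].
  by move=> A mA; rewrite /= /induced_charge restrict_EFin.
apply: cint_rep_opp; apply: cint_rep_density => //; [exact: toT| |exact: toD].
by move=> A mA; rewrite /= /induced_charge restrict_EFin.
Qed.

Lemma cdensity_zero mu D g : measurable (D : set T) ->
  (forall A, measurable (A : set T) -> mu A = 0%E) ->
  forall A, measurable (A : set T) -> cdensity g mu D A = 0%E.
Proof.
move=> mD mu0.
have pos0 A : measurable (A : set T) -> cpos mu A = 0%E.
  by move=> mA; have [] := jordan_zero (projT2 (hahnN mu)) mu0 mA.
have neg0 A : measurable (A : set T) -> cneg mu A = 0%E.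
  by move=> mA; have [] := jordan_zero (projT2 (hahnN mu)) mu0 mA.
move=> A mA; rewrite /cdensity; case: pselect => [fp|//]; case: pselect => [fn|//].
have z (m : {measure set T -> \bar R}) k : m.-integrable [set: T] k -> m A = 0%E ->
    (\int[m]_(x in A) k x = 0)%E.
  move=> ik mA0; apply: null_set_integral => //.
  by apply: measurable_funTS; exact: measurable_int ik.
have zp : induced_charge fp A = 0%E by exact: z fp (pos0 A mA).
have zn : induced_charge fn A = 0%E by exact: z fn (neg0 A mA).
transitivity (induced_charge fp A + (-1)%:E * induced_charge fn A)%E; first by [].
by rewrite zp zn mule0 adde0.
Qed.

Lemma cint_rep_dirac c a D f : measurable (D : set T) -> D a ->
  measurable_fun (D : set T) f -> cint_rep (cscaleC c (cdirac a)) D f (c * f a).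
Proof.
move=> mD Da mf.
pose m : {finite_measure set T -> \bar R} := dirac (a : T).
have idirac (E : set T) (k : T -> R) : measurable E -> measurable_fun E k ->
    m.-integrable E (EFin \o k).
  move=> mE mk; apply/integrableP; split; first exact/measurable_EFinP.
  rewrite integral_dirac //; last by apply: measurableT_comp => //; exact/measurable_EFinP.
  by rewrite diracE; case: (_ \in _); rewrite ?mul1e ?mul0e ltry.
have -> : c * f a = Rintegral m D (fun x => f x * c).
  rewrite /Rintegral integral_dirac //; last first.
    by apply/measurable_EFinP; apply: measurable_funM.
  by rewrite diracE mem_set // mul1e mulrC.
apply: cint_rep_density => //.
- exact: idirac.
- move=> A mA; rewrite integral_dirac //.
  by rewrite muleC.
- by apply: idirac => //; apply: measurable_funM.
Qed.

Lemma cint_rep_big (I : Type) (r : seq I) (P : pred I) (nu : I -> borel_charge R) D f v :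
  measurable (D : set T) -> measurable_fun (D : set T) f ->
  (forall i, P i -> cint_rep (nu i) D f (v i)) ->
  cint_rep (\big[@caddC R/@czeroC R]_(i <- r | P i) nu i) D f (\sum_(i <- r | P i) v i).
Proof.
move=> mD mf rep; elim: r => [|i r IH]; first by rewrite !big_nil; exact: cint_rep_zero.
rewrite !big_cons; case: ifP => // Pi; apply: cint_rep_add => //; exact: rep.
Qed.

End CintegralTheory.

(** * The bilinear form of the deformed measure matrix *)

Lemma bil_unique (R : realType) (G : nat -> nat -> R) (L : {poly R} -> {poly R} -> R) :
  (forall c f1 f2 g, L (c *: f1 + f2) g = c * L f1 g + L f2 g) ->
  (forall c f g1 g2, L f (c *: g1 + g2) = c * L f g1 + L f g2) ->
  (forall i j, L 'X^i 'X^j = G i j) -> forall f g, bil G f g = L f g.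
Proof.
move=> Ll Lr LX.
have add0 (x : R) : x = 1 * x + x -> x = 0.
  by rewrite mul1r => /(congr1 (fun y => y - x)); rewrite subrr addrK.
have L0l g : L 0 g = 0 by apply: add0; rewrite -Ll scaler0 addr0.
have L0r f : L f 0 = 0 by apply: add0; rewrite -Lr scaler0 addr0.
have sl I (r : seq I) (c : I -> R) (p : I -> {poly R}) g :
    L (\sum_(i <- r) c i *: p i) g = \sum_(i <- r) c i * L (p i) g.
  by elim: r => [|i r IH]; rewrite ?big_nil // !big_cons Ll IH.
have sr I (r : seq I) (c : I -> R) f (p : I -> {poly R}) :
    L f (\sum_(i <- r) c i *: p i) = \sum_(i <- r) c i * L f (p i).
  by elim: r => [|i r IH]; rewrite ?big_nil // !big_cons Lr IH.
move=> f g; rewrite -{2}[f]coefK -{2}[g]coefK !poly_def sl.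
rewrite /bil; apply: eq_bigr => i _; rewrite sr mulr_sumr.
by apply: eq_bigr => j _; rewrite LX mulrA mulrAC.
Qed.

Section Forms.
Variables (R : realType) (W : measure_matrix R) (s : nat) (n : 'I_s -> nat)
  (q : 'I_s -> R) (xi : 'I_s -> nat -> nat -> R).
Hypotheses (measW : is_measure_matrix W) (qW : forall i, ~ mm_Omega W (q i)).
Local Notation T := (measurableTypeR R).
Local Notation Q := (Qpoly n q).
Local Notation mu := (mm_entry W).
Local Notation Om := (mm_supp W).
Local Notation ord := (mm_order W).
Implicit Types f h : {poly R}.

Lemma closed_supp i j : closed (Om i j).
Proof. by case: measW => c _ _ _; exact: c. Qed.

Lemma moments_supp i j : finite_moments (mu i j) (Om i j).
Proof. by case: measW => _ _ _ m l; exact: m. Qed.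

Let mOm i j : measurable (Om i j : set T).
Proof. by apply: closed_measurableT; exact: closed_supp. Qed.

Lemma notin_supp a i j : ~ mm_Omega W a -> (i <= ord)%N -> (j <= ord)%N -> ~ Om i j a.
Proof. by move=> Wa io jo Oa; apply: Wa; exists i, j. Qed.

Lemma bounded_away_Q i j : (i <= ord)%N -> (j <= ord)%N -> bounded_away (Om i j) Q.
Proof.
move=> io jo; apply: bounded_away_prod => k; apply: bounded_awayX.
by apply: bounded_away_XsubC; [exact: closed_supp|exact: notin_supp].
Qed.

(** The pairing [(f, h / Q; W)], through the closed form of the derivatives. *)
Definition Lform f h : R :=
  \sum_(i < ord.+1) \sum_(m < ord.+1)
    cintegral (mu i m) (Om i m) (fun x => f^`(i).[x] * rat_deriv Q m h x).

Definition mass_form f h : R :=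
  \sum_k \sum_(a < n k) \sum_(b < n k) xi k a b * tcoef a (q k) f * tcoef b (q k) h.

Let iL (i m : 'I_ord.+1) f h :
  cintegrable (mu i m) (Om i m) (fun x => f.[x] * rat_deriv Q m h x).
Proof.
apply: cintegrable_horner_rat; [exact: closed_supp|exact: moments_supp|].
by apply: bounded_away_Q; rewrite -ltnS.
Qed.

Lemma Lform_linearl c f1 f2 h :
  Lform (c *: f1 + f2) h = c * Lform f1 h + Lform f2 h.
Proof.
rewrite /Lform mulr_sumr -big_split; apply: eq_bigr => i _ /=.
rewrite mulr_sumr -big_split; apply: eq_bigr => m _ /=.
rewrite -cintegralZ // -cintegralD //; last exact: cintegrableZ.
by apply: eq_cintegral => x _; rewrite derivnD derivnZ hornerD hornerZ mulrDl -mulrA.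
Qed.

Lemma Lform_linearr c f h1 h2 :
  Lform f (c *: h1 + h2) = c * Lform f h1 + Lform f h2.
Proof.
rewrite /Lform mulr_sumr -big_split; apply: eq_bigr => i _ /=.
rewrite mulr_sumr -big_split; apply: eq_bigr => m _ /=.
rewrite -cintegralZ // -cintegralD //; last exact: cintegrableZ.
by apply: eq_cintegral => x _; rewrite rat_derivD rat_derivZ mulrDr mulrCA.
Qed.

Lemma mass_form_linearl c f1 f2 h :
  mass_form (c *: f1 + f2) h = c * mass_form f1 h + mass_form f2 h.
Proof.
rewrite /mass_form mulr_sumr -big_split; apply: eq_bigr => k _ /=.
rewrite mulr_sumr -big_split; apply: eq_bigr => a _ /=.
rewrite mulr_sumr -big_split; apply: eq_bigr => b _ /=.
by rewrite tcoefD {1}/tcoef comp_polyZ coefZ -/(tcoef _ _ _); ring.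
Qed.

Lemma mass_form_linearr c f h1 h2 :
  mass_form f (c *: h1 + h2) = c * mass_form f h1 + mass_form f h2.
Proof.
rewrite /mass_form mulr_sumr -big_split; apply: eq_bigr => k _ /=.
rewrite mulr_sumr -big_split; apply: eq_bigr => a _ /=.
rewrite mulr_sumr -big_split; apply: eq_bigr => b _ /=.
by rewrite [X in _ * X]tcoefD {2}/tcoef comp_polyZ coefZ -/(tcoef _ _ _); ring.
Qed.

Lemma mass_form_Q f h : mass_form f (Q * h) = 0.
Proof.
apply: big1 => k _; apply: big1 => a _; apply: big1 => b _.
rewrite [X in _ * X](@tcoef_dvdp _ _ _ (n k)) ?mulr0 //.
by rewrite dvdp_mulr // (Qpoly_split _ _ k) dvdp_mulIr.
Qed.

Lemma sform_horner f h : sform W (fun x => f.[x]) (fun x => h.[x]) = Lform f (Q * h).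
Proof.
apply: eq_bigr => i _; apply: eq_bigr => j _; apply: eq_cintegral => x /set_mem Ox.
rewrite !derive1n_horner rat_deriv_mulV //.
by apply: bounded_away_neq0 Ox; apply: bounded_away_Q; rewrite -ltnS.
Qed.

Lemma closed_Omega : closed (mm_Omega W).
Proof.
have -> : mm_Omega W = \bigcup_(ij in [set ij : nat * nat | (ij.1 <= ord)%N && (ij.2 <= ord)%N])
    Om ij.1 ij.2.
  apply/seteqP; split => [x [i [j [io jo Ox]]]|x [[i j] /= /andP[io jo] Ox]].
    by exists (i, j) => //=; rewrite io jo.
  by exists i, j.
apply: closed_bigcup => [|ij _]; last exact: closed_supp.
apply: (@sub_finite_set _ _ (`I_ord.+1 `*` `I_ord.+1)).
  by move=> [i j] /= /andP[io jo]; split; rewrite /= ltnS.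
by apply: finite_setX; exact: finite_II.
Qed.

Let D : set R := mm_Omega W `|` range q.

Let mD : measurable (D : set T).
Proof.
apply: closed_measurableT; apply: closedU; first exact: closed_Omega.
have -> : range q = \bigcup_(k in [set: 'I_s]) [set q k].
  by apply/seteqP; split => [x [k _ <-]|x [k _ ->]]; exists k.
apply: closed_bigcup => [|k _]; first exact: finite_finset.
exact/accessible_closed_set1/hausdorff_accessible/Rhausdorff.
Qed.

Local Notation K := (deformed_order n W).+1.

Let entry_density i j m (p : {poly R}) : R :=
  if (i <= ord)%N then cintegral (mu i m) (Om i m)
    (fun x => p.[x] * ('C(m, j)%:R * rat_deriv Q (m - j) 1 x)) else 0.

Let entry_mass i j (p : {poly R}) : R :=
  \sum_(k < s | (i < n k)%N && (j < n k)%N) xi k i j / (i`!%:R * j`!%:R) * p.[q k].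

Lemma cintegral_entry i j p :
  cintegral (mm_entry (geronimusR n q xi W) i j) D (fun x => p.[x])
  = \sum_(m < ord.+1) entry_density i j m p + entry_mass i j p.
Proof.
have mp : measurable_fun (D : set T) (fun x : T => p.[x]) by exact: measurable_horner.
apply: (proj2 (cint_rep_cintegral mD _ _)); first exact: measurable_horner.
apply: cint_rep_add => //.
  apply: (@cint_rep_big _ _ _ _ _ _ _ (fun m : 'I_ord.+1 => entry_density i j m p)) => // m _.
  rewrite /entry_density; case: leqP => [io|io]; last first.
    (* The supports beyond the order may contain zeros of [Q], where the density is
       out of control, but they carry the zero charge. *)
    apply: cint_rep_zero => // A mA; apply: cdensity_zero => // B mB.
    by case: measW => _ _ z _; apply: z; rewrite // leqNgt io.
  have mo : (m <= ord)%N by rewrite -ltnS.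
  have bQ := bounded_away_Q io mo.
  have gE : {in Om i m, (fun x => 'C(m, j)%:R * rat_deriv Q (m - j) 1 x)
                        =1 (fun x => Qinv n q (strans (Xmat x)) m j)}.
    by move=> x /set_mem Ox; rewrite QinvE // (bounded_away_neq0 bQ).
  have ig : cintegrable (mu i m) (Om i m) (fun x => 'C(m, j)%:R * rat_deriv Q (m - j) 1 x).
    apply: (eq_cintegrable _
      (f := fun x => ('C(m, j)%:R%:P : {poly R}).[x] * rat_deriv Q (m - j) 1 x)) => //.
      by move=> x _; rewrite hornerC.
    by apply: cintegrable_horner_rat => //; [exact: closed_supp|exact: moments_supp].
  have ifg : cintegrable (mu i m) (Om i m)
      (fun x => p.[x] * ('C(m, j)%:R * rat_deriv Q (m - j) 1 x)).
    apply: (eq_cintegrable _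
      (f := fun x => ('C(m, j)%:R *: p).[x] * rat_deriv Q (m - j) 1 x)) => //.
      by move=> x _; rewrite hornerZ [RHS]mulrCA -[LHS]mulrA.
    by apply: cintegrable_horner_rat => //; [exact: closed_supp|exact: moments_supp].
  rewrite (@eq_cintegral _ _ _ _ (fun x => p.[x] * Qinv n q (strans (Xmat x)) m j)); last first.
    by move=> x xO; rewrite gE.
  apply: cint_rep_cdensity => //.
  - by move=> x Ox; left; exists i, m.
  - exact: eq_cintegrable gE ig.
  - by apply: eq_cintegrable ifg => // x xO; rewrite gE.
apply: cint_rep_big => // k _; apply: (@cint_rep_dirac _ _ _ _ (fun x => p.[x])) => //.
by right; exists k.
Qed.

Lemma sform_geronimusR f h :
  sform (geronimusR n q xi W) (fun x => f.[x]) (fun x => h.[x])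
  = Lform f h + mass_form f h.
Proof.
transitivity (\sum_(i < K) \sum_(j < K)
    (\sum_(m < ord.+1) entry_density i j m (f^`(i) * h^`(j)) + entry_mass i j (f^`(i) * h^`(j)))).
  apply: eq_bigr => i _; apply: eq_bigr => j _; rewrite -cintegral_entry.
  by apply: eq_cintegral => x _; rewrite !derive1n_horner hornerM.
under eq_bigr do rewrite big_split.
rewrite big_split /=; congr (_ + _).
  have oK : (ord.+1 <= K)%N by rewrite ltnS leq_maxl.
  rewrite /Lform (big_ord_widen K (fun i => \sum_(m < ord.+1) cintegral (mu i m) (Om i m)
     (fun x => f^`(i).[x] * rat_deriv Q m h x)) oK) [RHS]big_mkcond /=.
  apply: eq_bigr => i _; rewrite exchange_big /= ltnS /entry_density.
  case: ifP => io; last by rewrite big1 // => m _; rewrite big1.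
  apply: eq_bigr => m _; have mo : (m <= ord)%N by rewrite -ltnS.
  have bQ := bounded_away_Q io mo.
  rewrite -cintegral_sum // => [|j _]; last first.
    apply: (eq_cintegrable _ (f := fun x =>
      ('C(m, j)%:R *: (f^`(i) * h^`(j))).[x] * rat_deriv Q (m - j) 1 x)) => //.
      by move=> x _; rewrite hornerZ [RHS]mulrCA -[LHS]mulrA.
    by apply: cintegrable_horner_rat => //; [exact: closed_supp|exact: moments_supp].
  apply: eq_cintegral => x /set_mem Ox.
  rewrite -(@rat_deriv_Leibniz _ _ _ _ _ (bounded_away_neq0 bQ Ox) (deformed_order n W)).
    by rewrite mulr_sumr; apply: eq_bigr => j _; rewrite hornerM; ring.
  exact: leq_trans (ltn_ord m) oK.
have nK k : (n k <= K)%N.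
  apply: (leq_trans (leqSpred _)); rewrite ltnS leq_max.
  by rewrite (leq_bigmax k) orbT.
rewrite /entry_mass; under eq_bigr do rewrite (exchange_big_dep xpredT) //=.
rewrite exchange_big /=; apply: eq_bigr => k _.
rewrite (big_ord_widen K (fun a =>
  \sum_(b < n k) xi k a b * tcoef a (q k) f * tcoef b (q k) h) (nK k)).
rewrite [RHS]big_mkcond /=; apply: eq_bigr => i _.
case: ifP => ik; last by rewrite big_pred0 // => j; rewrite ik.
rewrite (big_ord_widen K (fun b => xi k i b * tcoef i (q k) f * tcoef b (q k) h) (nK k)).
apply: eq_big => [j|j _]; first by rewrite ?ik.
have f0 a : (a`!)%:R != 0 :> R by rewrite pnatr_eq0 -lt0n fact_gt0.
rewrite hornerM !derivn_tcoef.
move: (f0 i) (f0 j); move: (i`!%:R) (j`!%:R) => u v u0 v0.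
by field; rewrite u0 v0.
Qed.

Lemma bil_geronimusR f h : bil (gram (geronimusR n q xi W)) f h = Lform f h + mass_form f h.
Proof.
apply: (bil_unique (L := fun f h => Lform f h + mass_form f h)) => [c f1 f2 g|c g h1 h2|i j].
- by rewrite Lform_linearl mass_form_linearl mulrDr addrACA.
- by rewrite Lform_linearr mass_form_linearr mulrDr addrACA.
- rewrite -sform_geronimusR /gram; congr (sform _ _ _); apply/funext => x;
  by rewrite hornerXn.
Qed.

Lemma bil_gram f h : bil (gram W) f h = Lform f (Q * h).
Proof.
apply: (bil_unique (L := fun f h => Lform f (Q * h))) => [c f1 f2 g|c g h1 h2|i j].
- by rewrite Lform_linearl.
- by rewrite mulrDr -scalerAr Lform_linearr.
- rewrite -sform_horner /gram; congr (sform _ _ _); apply/funext => x;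
  by rewrite hornerXn.
Qed.

(** The masses do not see the multiples of [Q], and dividing [Q * h] by [Q] gives
    back the form of [W]. *)
Lemma bil_geronimusR_Q f h :
  bil (gram (geronimusR n q xi W)) f (Q * h) = bil (gram W) f h.
Proof. by rewrite bil_geronimusR mass_form_Q addr0 bil_gram. Qed.

End Forms.

(** * Derivatives of the functions of the second kind *)

Lemma derive1n_tower (R : realType) (U : set R) (f : R -> R) (G : nat -> R -> R) :
  open U -> (forall k y, U y -> is_derive y 1 (G k) (G k.+1 y)) ->
  (forall y, U y -> f y = G 0 y) ->
  forall k y, U y -> derive1n k f y = G k y.
Proof.
move=> oU dG f0; elim=> [|k IH] y Uy; first exact: f0.
rewrite derive1nS derive1E (@near_eq_derive _ _ _ _ (G k)).
  by have dGy := dG k y Uy; rewrite derive_val.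
by near=> z; apply: IH; near: z; exact: open_nbhs_nbhs.
Unshelve. all: by end_near. Qed.

Section Towers.
Variable R : realType.
Implicit Types (a x y : R) (p V : {poly R}).

Lemma is_derive_horner p x : is_derive x 1 (fun y => p.[y]) (p^`()).[x].
Proof.
apply: DeriveDef; first exact: derivable_horner.
by rewrite -derive1E derivE.
Qed.

Lemma open_neq a : open [set y : R | y != a].
Proof.
have -> : [set y : R | y != a] = ~` [set a].
  by apply/seteqP; split => y /= /eqP.
apply: closed_openC; exact/accessible_closed_set1/hausdorff_accessible/Rhausdorff.
Qed.

Lemma open_horner_neq0 V : open [set y : R | V.[y] != 0].
Proof.
have := @open_comp _ _ (horner V) [set y : R | y != 0].
by apply => [y _|]; [exact: continuous_horner|exact: open_neq].
Qed.

Lemma is_derive_inv_exp (f : R -> R) (df : R) m x : f x != 0 -> is_derive x 1 f df ->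
  is_derive x 1 (fun y => ((f y)^-1) ^+ m.+1) (- m.+1%:R * df * ((f x)^-1) ^+ m.+2).
Proof.
move=> fx0 fd.
have iV : is_derive x 1 (fun y => (f y)^-1) (- (f x) ^- 2 *: df) by exact: is_deriveV.
have -> : (fun y => ((f y)^-1) ^+ m.+1) = (fun y => (f y)^-1) ^+ m.+1.
  by apply/funext => y; rewrite exprfctE.
apply: is_derive_eq; rewrite /GRing.scale /=.
by rewrite !exprVn !exprS; field; rewrite expf_neq0 fx0.
Qed.

Lemma is_derive_rat_deriv V p k x : V.[x] != 0 ->
  is_derive x 1 (rat_deriv V k p) (rat_deriv V k.+1 p x).
Proof.
move=> Vx; have dn := is_derive_horner (rat_num V k p) x.
have dV := is_derive_inv_exp k Vx (is_derive_horner V x).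
have -> : rat_deriv V k p = (fun y => (rat_num V k p).[y] * ((V.[y])^-1) ^+ k.+1).
  by apply/funext => y; rewrite /rat_deriv exprVn.
apply: is_derive_eq; rewrite -![_ *: _]/(_ * _) /rat_deriv.
have -> : (rat_num V k.+1 p).[x] = (rat_num V k p)^`().[x] * V.[x]
    - k.+1%:R * ((rat_num V k p).[x] * V^`().[x]) by rewrite !hornerE.
by rewrite !exprVn !exprS; field; rewrite expf_neq0 Vx.
Qed.

Lemma derive1n_rat V p (f : R -> R) k x :
  (forall y, V.[y] != 0 -> f y = p.[y] / V.[y]) -> V.[x] != 0 ->
  derive1n k f x = rat_deriv V k p x.
Proof.
move=> fE Vx.
apply: (@derive1n_tower _ [set y | V.[y] != 0] f (fun k => rat_deriv V k p)) => //.
- exact: open_horner_neq0.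
- by move=> j y; exact: is_derive_rat_deriv.
Qed.

Lemma derive1n_inv_exp a m k x : x != a ->
  derive1n k (fun y => ((y - a)^-1) ^+ m.+1) x
  = (-1) ^+ k * ((m + k) ^_ k)%:R * ((x - a)^-1) ^+ (m + k).+1.
Proof.
move: k x; apply: (@derive1n_tower _ [set y | y != a] _
  (fun k y => (-1) ^+ k * ((m + k) ^_ k)%:R * ((y - a)^-1) ^+ (m + k).+1)).
- exact: open_neq.
- move=> k y /= ya; have ya0 : y - a != 0 by rewrite subr_eq0.
  have d1 : is_derive y 1 (fun z => z - a) 1 by apply: is_derive_eq; rewrite ?subr0.
  have dk := @is_derive_inv_exp (fun z => z - a) _ (m + k) _ ya0 d1.
  apply: is_derive_eq; rewrite -[_ *: _]/(_ * _) addnS ffactnS /= natrM [(-1) ^+ k.+1]exprS; ring.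
- by move=> y _; rewrite addn0 ffactn0 mul1r mul1r.
Qed.

Lemma derive1n_sub_inv a k x : x != a ->
  derive1n k (fun y => (a - y)^-1) x = k`!%:R * ((a - x)^-1) ^+ k.+1.
Proof.
move: k x; apply: (@derive1n_tower _ [set y | y != a] _
  (fun k y => k`!%:R * ((a - y)^-1) ^+ k.+1)).
- exact: open_neq.
- move=> k y /= ya; have ya0 : a - y != 0 by rewrite subr_eq0 eq_sym.
  have d1 : is_derive y 1 (fun z => a - z) (- 1).
    rewrite -[- 1]sub0r; exact: (is_deriveB (is_derive_cst a y 1) (is_derive_id y 1)).
  have dk := @is_derive_inv_exp (fun z => a - z) _ k _ ya0 d1.
  apply: is_derive_eq; rewrite -[_ *: _]/(_ * _) factS natrM; ring.
- by move=> y _; rewrite mul1r expr1.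
Qed.

End Towers.

(** * Cauchy integrals off the support *)

Section CauchyIntegral.
Variable R : realType.
Local Notation T := (measurableTypeR R).
Variables (mu : borel_charge R) (D : set R) (g : {poly R}).
Hypotheses (cD : closed D) (mom : finite_moments mu D).
Let mD := closed_measurableT cD.

Definition cauchy_kernel (m : nat) (y x : R) : R := g.[x] * ((y - x)^-1) ^+ m.+1.

Definition cauchy_integral (m : nat) (y : R) : R := cintegral mu D (cauchy_kernel m y).

Lemma cintegrable_cauchy_kernel m y : ~ D y -> cintegrable mu D (cauchy_kernel m y).
Proof.
move=> nDy; have [c c0 cV] := bounded_away_XsubC cD nDy.
have bV : bounded_away D ((y%:P - 'X) ^+ m.+1).
  apply: bounded_awayX; exists c => // x Dx.
  by have := cV x Dx; rewrite !hornerE distrC.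
apply: (eq_cintegrable mD) (cintegrable_rat cD mom g bV) => x _.
by rewrite /cauchy_kernel !hornerE exprVn.
Qed.

Lemma is_derive_cauchy_kernel m (y x : R) : y != x ->
  is_derive y 1 (cauchy_kernel m ^~ x) (- m.+1%:R * cauchy_kernel m.+1 y x).
Proof.
move=> yx; have y0 : y - x != 0 by rewrite subr_eq0.
have d1 : is_derive y 1 (fun z => z - x) 1 by apply: is_derive_eq; rewrite ?subr0.
have dk := @is_derive_inv_exp _ (fun z => z - x) _ m _ y0 d1.
rewrite /cauchy_kernel; apply: is_derive_eq; rewrite -[_ *: _]/(_ * _); ring.
Qed.

(** Differentiation under the integral sign: the derivatives are dominated because
    near [y0] the points stay at a positive distance from the closed set [D]. *)
Lemma is_derive_cauchy_Rintegral (nu : {measure set T -> \bar R}) m (y0 : R) : ~ D y0 ->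
  (forall j y, ~ D y -> nu.-integrable D (EFin \o cauchy_kernel j y)) ->
  nu.-integrable D (EFin \o (horner g)) ->
  is_derive y0 1 (fun y => Rintegral nu D (cauchy_kernel m y))
    (- m.+1%:R * Rintegral nu D (cauchy_kernel m.+1 y0)).
Proof.
move=> nDy ik ig; have [c c0 cV] := bounded_away_XsubC cD nDy.
(* Within [c / 2] of [y0] every point keeps the distance [c / 2] from [D]. *)
have cD' y x : y0 - c / 2 < y < y0 + c / 2 -> D x -> c / 2 <= `|y - x|.
  move=> /andP[y1 y2] Dx; have := cV x Dx; rewrite !hornerE => cx.
  have y3 : `|y - y0| < c / 2 by rewrite ltr_distl y1 y2.
  have : `|x - y0| <= `|y - y0| + `|y - x|.
    by rewrite [`|y - x|]distrC [leRHS]addrC ler_distD.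
  move: cx y3; lra.
have c2 : 0 < c / 2 by rewrite divr_gt0.
have yx y x : y0 - c / 2 < y < y0 + c / 2 -> D x -> y != x.
  move=> yI Dx; have := cD' _ _ yI Dx; apply: contraTneq => ->.
  by rewrite subrr normr0 -ltNge.
have nD y : y0 - c / 2 < y < y0 + c / 2 -> ~ D y.
  by move=> yI Dy; have := yx _ _ yI Dy; rewrite eqxx.
pose G (x : T) := m.+1%:R * ((c / 2)^-1) ^+ m.+2 * `|g.[x]|.
have G0 x : 0 <= G x.
  by apply: mulr_ge0 => //; apply: mulr_ge0 => //; apply: exprn_ge0; rewrite invr_ge0 ltW.
have iG : nu.-integrable D (EFin \o G).
  have := integrableZl mD (m.+1%:R * ((c / 2)^-1) ^+ m.+2) (integrable_norm ig).
  by apply: eq_integrable.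
have I0 : [set` `]y0 - c / 2, y0 + c / 2[] y0.
  by rewrite /= in_itv /=; apply/andP; split; lra.
have d1 y x : [set` `]y0 - c / 2, y0 + c / 2[] y -> D x ->
    is_derive y 1 (cauchy_kernel m ^~ x) (- m.+1%:R * cauchy_kernel m.+1 y x).
  by rewrite /= in_itv => yI Dx; apply: is_derive_cauchy_kernel; exact: yx yI Dx.
have dE y x : [set` `]y0 - c / 2, y0 + c / 2[] y -> D x ->
    partial1of2 (cauchy_kernel m) y x = - m.+1%:R * cauchy_kernel m.+1 y x.
  by move=> yI Dx; rewrite partial1of2E; have dd := d1 _ _ yI Dx; rewrite derive_val.
have h1 y : [set` `]y0 - c / 2, y0 + c / 2[] y -> nu.-integrable D (EFin \o cauchy_kernel m y).
  by rewrite /= in_itv => yI; apply: ik; exact: nD.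
have h2 y x : [set` `]y0 - c / 2, y0 + c / 2[] y -> D x ->
    derivable (cauchy_kernel m ^~ x) y 1.
  by move=> yI Dx; have dd := d1 _ _ yI Dx; exact: ex_derive.
have h3 y x : [set` `]y0 - c / 2, y0 + c / 2[] y -> D x ->
    `|partial1of2 (cauchy_kernel m) y x| <= G x.
  move=> yI Dx; have yI' : y0 - c / 2 < y < y0 + c / 2 by move: yI; rewrite /= in_itv.
  have ax := cD' y x yI' Dx; have px := lt_le_trans c2 ax.
  rewrite dE // normrM normrN normr_nat /G -mulrA ler_wpM2l //.
  rewrite /cauchy_kernel normrM mulrC ler_wpM2r // normrX lerXn2r ?nnegrE ?invr_ge0 ?(ltW c2) //.
  by rewrite normfV lef_pV2 ?posrE.
apply: DeriveDef.
  exact: (derivable_under_integral mD I0 h1 h2 G0 iG h3).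
rewrite -derive1E (differentiation_under_integral mD I0 h1 h2 G0 iG h3).
rewrite -RintegralZl //; last exact: ik.
by apply: eq_Rintegral => x /set_mem Dx; rewrite -[LHS]/(partial1of2 (cauchy_kernel m) y0 x) dE.
Qed.

Lemma is_derive_cauchy_integral m (y0 : R) : ~ D y0 ->
  is_derive y0 1 (cauchy_integral m) (- m.+1%:R * cauchy_integral m.+1 y0).
Proof.
move=> nDy; have [g1 g2] := cintegrable_horner cD mom g.
have dp := @is_derive_cauchy_Rintegral (cpos mu) m y0 nDy
  (fun j y H => (cintegrable_cauchy_kernel j H).1) g1.
have dn := @is_derive_cauchy_Rintegral (cneg mu) m y0 nDy
  (fun j y H => (cintegrable_cauchy_kernel j H).2) g2.
rewrite /cauchy_integral /cintegral mulrBr.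
exact: is_deriveB.
Qed.

End CauchyIntegral.

(** * The germs of the functions of the second kind *)

Section SecondKind.
Variables (R : realType) (W : measure_matrix R) (s : nat) (n : 'I_s -> nat)
  (q : 'I_s -> R) (xi : 'I_s -> nat -> nat -> R).
Hypotheses (measW : is_measure_matrix W) (qW : forall i, ~ mm_Omega W (q i)).
Hypothesis q_inj : injective q.
Local Notation Q := (Qpoly n q).
Local Notation N := (\sum_(i < s) n i)%N.
Local Notation mu := (mm_entry W).
Local Notation Om := (mm_supp W).
Local Notation ord := (mm_order W).
Local Notation G' := (gram (geronimusR n q xi W)).
Local Notation E := (Qmat n q *m germs_chi n q).
Implicit Types (f h : {poly R}) (y : R).

Definition second_kind f y : R := sform W (fun x => f.[x]) (fun x => (y - x)^-1).

Definition second_kind_deriv b f y : R :=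
  \sum_(i < ord.+1) \sum_(j < ord.+1)
    (-1) ^+ b * (j + b)`!%:R * cauchy_integral (mu i j) (Om i j) f^`(i) (j + b) y.

Let off y (i j : 'I_ord.+1) : ~ mm_Omega W y -> ~ Om i j y.
Proof. by move=> Wy Oy; apply: Wy; exists i, j; split; rewrite // -ltnS. Qed.

Lemma second_kindE f y : ~ mm_Omega W y -> second_kind f y = second_kind_deriv 0 f y.
Proof.
move=> Wy; apply: eq_bigr => i _; apply: eq_bigr => j _.
rewrite expr0 mul1r addn0 -cintegralZ; last 2 first.
- by apply: closed_measurableT; exact: closed_supp.
- apply: cintegrable_cauchy_kernel; [exact: closed_supp|exact: moments_supp|exact: off].
apply: eq_cintegral => x /set_mem Ox; rewrite derive1n_horner derive1n_sub_inv.
  by rewrite /cauchy_kernel mulrCA.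
by apply/eqP => xy; apply: (@off y i j Wy); rewrite -xy.
Qed.

Lemma is_derive_second_kind_deriv b f y : ~ mm_Omega W y ->
  is_derive y 1 (second_kind_deriv b f) (second_kind_deriv b.+1 f y).
Proof.
move=> Wy; have -> : second_kind_deriv b f = \sum_(i < ord.+1) \sum_(j < ord.+1)
    (fun z => (-1) ^+ b * (j + b)`!%:R * cauchy_integral (mu i j) (Om i j) f^`(i) (j + b) z).
  apply/funext => z; rewrite fct_sumE; apply: eq_bigr => i _.
  by rewrite fct_sumE.
apply: is_derive_sum => i; apply: is_derive_sum => j.
have dI := is_derive_cauchy_integral f^`(i) (@closed_supp _ _ measW i j)
  (@moments_supp _ _ measW i j) (j + b) (@off y i j Wy).
apply: is_derive_eq; rewrite -![_ *: _]/(_ * _) addnS factS natrM exprS; ring.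
Qed.

Lemma second_kind_deriv_sum b (I : Type) (r : seq I) (c : I -> R) (p : I -> {poly R}) y :
  ~ mm_Omega W y ->
  second_kind_deriv b (\sum_(k <- r) c k *: p k) y
  = \sum_(k <- r) c k * second_kind_deriv b (p k) y.
Proof.
move=> Wy; have mO i j := closed_measurableT (@closed_supp _ _ measW i j).
have ic (i j : 'I_ord.+1) g m : cintegrable (mu i j) (Om i j) (cauchy_kernel g m y).
  by apply: cintegrable_cauchy_kernel; [exact: closed_supp|exact: moments_supp|exact: off].
under [RHS]eq_bigr do rewrite mulr_sumr.
rewrite exchange_big; apply: eq_bigr => i _ /=.
under [RHS]eq_bigr do rewrite mulr_sumr.
rewrite exchange_big; apply: eq_bigr => j _ /=.
under [RHS]eq_bigr do rewrite mulrCA.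
rewrite -mulr_sumr; congr (_ * _); rewrite /cauchy_integral.
under [RHS]eq_bigr do rewrite -cintegralZ //.
rewrite -cintegral_sum // => [|k _]; last exact: cintegrableZ.
apply: eq_cintegral => x _; rewrite /cauchy_kernel.
under [RHS]eq_bigr do rewrite mulrA.
rewrite -mulr_suml; congr (_ * _); rewrite linear_sum horner_sum.
by apply: eq_bigr => k _; rewrite /= derivnZ hornerZ.
Qed.

(** At the zeros of [Q] the derivatives of [1 / (y - x)] in [y] are, up to sign,
    the partial fractions [1 / (x - q_i)^(b+1) = (Q / (X - q_i)^(b+1)) / Q]. *)
Lemma second_kind_deriv_zero f i b : (b < n i)%N ->
  second_kind_deriv b f (q i) / b`!%:R = - Lform W n q f (zero_quotient n q i b).
Proof.
move=> bn; rewrite /second_kind_deriv /Lform mulr_suml -sumrN; apply: eq_bigr => a _.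
rewrite mulr_suml -sumrN; apply: eq_bigr => j _.
have nO := @off _ a j (@qW i).
have ic : cintegrable (mu a j) (Om a j) (cauchy_kernel f^`(a) (j + b) (q i)).
  by apply: cintegrable_cauchy_kernel; [exact: closed_supp|exact: moments_supp|].
rewrite (@eq_cintegral _ _ _ _ (fun x => (- (-1) ^+ b * ((b + j) ^_ j)%:R)
    * cauchy_kernel f^`(a) (j + b) (q i) x)); last first.
  move=> x /set_mem Ox; have xq : x != q i by apply/eqP => xq; apply: nO; rewrite -xq.
  have Qx : Q.[x] != 0.
    apply: (bounded_away_neq0 _ Ox); apply: bounded_away_Q => //.
      by rewrite -ltnS. by rewrite -ltnS.
  rewrite -(@derive1n_rat _ _ _ (fun y => ((y - q i)^-1) ^+ b.+1)) //; last first.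
    move=> y; rewrite -(zero_quotientE q bn) hornerM horner_exp hornerXsubC.
    rewrite mulf_eq0 negb_or => /andP[z0 yq].
    by rewrite exprVn invfM mulrA mulfV // mul1r.
  rewrite derive1n_inv_exp // /cauchy_kernel -[x - q i]opprB invrN.
  rewrite [(- (q i - x)^-1) ^+ _]exprNn [(j + b)%N]addnC.
  rewrite [(-1) ^+ (b + j).+1]exprS [(-1) ^+ (b + j)]exprD.
  have jj : (-1) ^+ j * (-1) ^+ j = 1 :> R by rewrite -exprD addnn -muln2 exprM sqrr_sign.
  set u := (q i - x)^-1 ^+ _; ring: jj.
rewrite cintegralZ //; last by apply: closed_measurableT; exact: closed_supp.
rewrite -/(cauchy_integral _ _ _ _ _) !mulNr opprK mulrAC; congr (_ * _).
rewrite -mulrA; congr (_ * _); rewrite [(j + b)%N]addnC.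
by rewrite -(ffact_fact (leq_addl b j)) addnK natrM mulfK.
Qed.

Let off_open : open (~` mm_Omega W).
Proof. by apply: closed_openC; exact: closed_Omega. Qed.

Lemma germs_second_kind (phi : R -> R) f :
  (forall y, ~ mm_Omega W y -> phi y = second_kind f y) ->
  germs n q phi = \mxrow_(i < s) (\row_(b < n i) - Lform W n q f (zero_quotient n q i b)).
Proof.
move=> phiE; apply: eq_mxrow => i; apply/rowP => b; rewrite !mxE.
rewrite -second_kind_deriv_zero //; congr (_ / _).
apply: (@derive1n_tower _ _ phi (fun b => second_kind_deriv b f) off_open).
- by move=> k y; exact: is_derive_second_kind_deriv.
- by move=> y Wy; rewrite phiE // second_kindE.
- exact: qW.
Qed.

Lemma mass_form_zero f i (b : 'I_(n i)) : mass_form n q xi f (zero_quotient n q i b)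
  = ((\row_(a < n i) tcoef a (q i) f) *m
      (trunc (n i) (xi i) *m anti_id R (n i) *m Tmat n q i)) 0 b.
Proof.
rewrite /mass_form (bigD1 i) //= [X in _ + X]big1 ?addr0 => [|k ki]; last first.
  apply: big1 => a _; apply: big1 => c _.
  by rewrite tcoef_zero_quotient_neq ?mulr0 // eq_sym.
rewrite -mulmxA mulmxA mxE.
under [RHS]eq_bigr do rewrite mxE mulr_suml.
rewrite exchange_big /=; apply: eq_bigr => a _; apply: eq_bigr => c _.
by rewrite tcoef_zero_quotient !mxE; ring.
Qed.

(** The vector [Phi] records the pairings with the basis [Q / (X - q_i)^(b+1)]
    of the polynomials of degree less than [N]: the Cauchy integrals give the part of
    the form that comes from [W / Q], the matrix [XiR] the masses. *)
Lemma germs_defect (phi : R -> R) f :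
  (forall y, ~ mm_Omega W y -> phi y = second_kind f y) ->
  germs n q phi - germs n q (fun x => f.[x]) *m XiR n q xi = defect G' E f.
Proof.
move=> phiE; rewrite (germs_second_kind phiE) germs_hornerE /XiR mul_mxrow_mxdiag.
rewrite -mxrowB /defect Qmat_germs_chiE // mul_mxrow -mxrowN.
apply: eq_mxrow => i; apply/rowP => b; rewrite [LHS]mxE [X in X + _ = _]mxE.
rewrite [X in _ + X = _]mxE -mass_form_zero -opprD -bil_geronimusR // [RHS]mxE.
rewrite (bil_expandr _ _ (size_zero_quotient q (ltn_ord b))).
rewrite mxE; congr (- _); apply: eq_bigr => m _.
by rewrite !mxE mulrC.
Qed.

Variable F : lu_data R.

Lemma PhiR_defect l : PhiR n q xi W F l = defect G' E (poly1 F l).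
Proof. exact: germs_defect. Qed.

(** In the variable on which the germs are taken, the mixed kernel is the function of
    the second kind of the polynomial that the kernel [K] is. *)
Lemma kernel_rowR_poly k x :
  kernel_rowR n q xi W F k x
  = \row_b (kernel_poly G' F (Qpoly n q) E k b).[x].
Proof.
pose c (j : 'I_k) := (poly2 F j).[x] * (lu_h F j)^-1.
pose f := \sum_(j < k) c j *: poly1 F j.
have fK : (fun y => kernelK F k x y) = (fun y => f.[y]).
  apply/funext => y; rewrite /kernelK horner_sum.
  by apply: eq_bigr => j _; rewrite hornerZ.
have fM y : ~ mm_Omega W y -> mixed_kernel2 W F k x y = second_kind f y.
  move=> Wy; rewrite second_kindE // second_kind_deriv_sum //.
  by apply: eq_bigr => j _; rewrite -second_kindE.
rewrite /kernel_rowR fK (germs_defect fM) /f defect_sum; apply/rowP => b.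
rewrite [LHS]mxE [RHS]mxE /kernel_poly hornerD hornerM; congr (_ + _).
  rewrite mxE; congr (_ * _); rewrite summxE horner_sum; apply: eq_bigr => j _.
  by rewrite [LHS]mxE hornerZ /c mulrC [X in _ * X]mulrC mulrA.
rewrite -mulmxA mxE horner_sum; apply: eq_bigr => m _.
by rewrite hornerZ hornerXn [chi_row _ _ _ _]mxE mulrC.
Qed.

End SecondKind.

(** * The formulas for the right deformation *)

Section RightDeformation.
Variables (R : realType) (W : measure_matrix R) (s : nat) (n : 'I_s -> nat)
  (q : 'I_s -> R) (xi : 'I_s -> nat -> nat -> R) (F FR : lu_data R).
Local Notation N := (\sum_(i < s) n i)%N.
Local Notation WR := (geronimusR n q xi W).
Hypotheses (measW : is_measure_matrix W) (q_inj : injective q)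
  (qW : forall i, ~ mm_Omega W (q i)).
Hypotheses (facG : LU_factorizable (gram W)) (facR : LU_factorizable (gram WR))
  (luG : LU_factorization (gram W) F) (luR : LU_factorization (gram WR) FR).

Let Q_size := size_Qpoly n q.
Let Q_monic := Qpoly_monic n q.
Let E_unit : Qmat n q *m germs_chi n q \in unitmx := Qmat_germs_chi_unit n q_inj.
Let bilQ f g : bil (gram WR) f (Qpoly n q * g) = bil (gram W) f g.
Proof. exact: bil_geronimusR_Q. Qed.

Lemma PhiR_blockE l : PhiR_block n q xi W F l
  = \matrix_(i < N) defect (gram WR) (Qmat n q *m germs_chi n q) (poly1 F (l + i)).
Proof. by apply/row_matrixP => i; rewrite !rowK PhiR_defect. Qed.

Lemma right_formulas_high k : (0 < N)%N -> (N <= k)%N ->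
  let e0 : 'cV[R]_N := \col_(i < N) (i == 0%N :> nat)%:R in
  let h := lu_h F in
  let A := PhiR_block n q xi W F (k - N) in
  [/\ A \in unitmx,
      forall x, (poly1 FR k).[x] =
        Theta_star A (\col_(i < N) (poly1 F (k - N + i)).[x])
                   (PhiR n q xi W F k) (poly1 F k).[x],
      lu_h FR k = h (k - N)%N * Theta_star A e0 (PhiR n q xi W F k) 0
    & forall x, (poly2 FR k).[x] / - h (k - N)%N =
        Theta_star A e0 (kernel_rowR n q xi W F k x) 0].
Proof.
move=> N0 Nk e0 h A; rewrite /A PhiR_blockE PhiR_defect //; split.
- exact: (Phi_unit facG facR luG luR Q_size Q_monic E_unit bilQ Nk).
- exact: (deformed_poly1_Theta facG facR luG luR Q_size Q_monic E_unit bilQ Nk).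
- exact: (deformed_norm_Theta facG facR luG luR Q_size Q_monic E_unit bilQ Nk N0).
- move=> x; apply: (deformed_poly2_Theta facG facR luG luR Q_size Q_monic E_unit bilQ Nk N0).
  exact: kernel_rowR_poly.
Qed.

Lemma right_formulas_low (k : 'I_N) :
  let w : 'I_k -> 'I_N := widen_ord (ltnW (ltn_ord k)) in
  let M := PiR n q xi W F in
  [/\ mxsub w w M \in unitmx,
      forall x, (poly1 FR k).[x] =
        Theta_star (mxsub w w M) (\col_(i < k) (poly1 F i).[x])
                   (\row_(j < k) M k (w j)) (poly1 F k).[x],
      forall x, (poly2 FR k).[x] =
        Theta_star (mxsub w w M^T) (\col_(i < k) x ^+ i)
                   (\row_(j < k) M^T k (w j)) (x ^+ k)
    & lu_h FR k =
        - Theta_star (mxsub w w M) (\col_(i < k) M (w i) k)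
                     (\row_(j < k) M k (w j)) (M k k)].
Proof.
move=> w M; have {}M_E : M = (\matrix_(i < N) defect (gram WR) (Qmat n q *m germs_chi n q)
    (poly1 F i)) *m invmx (Qmat n q *m germs_chi n q) by rewrite /M /PiR PhiR_blockE.
rewrite M_E; split.
- exact: (low_moment_unit facG facR luG luR E_unit).
- exact: (deformed_poly1_low facG facR luG luR E_unit).
- exact: (deformed_poly2_low facG facR luG luR E_unit).
- exact: (deformed_norm_low facG facR luG luR E_unit).
Qed.

End RightDeformation.

(** * Transposition *)

Section Transposition.
Variable R : realType.

(** The left deformation of [W] is the transpose of the right deformation of the
    transpose of [W], with transposed masses. *)
Definition mm_trans (W : measure_matrix R) : measure_matrix R :=
  MeasureMatrix (mm_order W) (fun i j => mm_entry W j i) (fun i j => mm_supp W j i).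

Variables (W : measure_matrix R) (s : nat) (n : 'I_s -> nat)
  (q : 'I_s -> R) (xi : 'I_s -> nat -> nat -> R) (F : lu_data R).
Local Notation xiT := (fun k => strans (xi k)).

Lemma is_measure_matrix_trans : is_measure_matrix W -> is_measure_matrix (mm_trans W).
Proof.
move=> [c z o m]; split => /=.
- by move=> i j; exact: c.
- by move=> i j; exact: z.
- by move=> i j ij; apply: o; rewrite andbC.
- by move=> i j l; exact: m.
Qed.

Lemma mm_Omega_trans : mm_Omega (mm_trans W) = mm_Omega W.
Proof. by apply/seteqP; split => x [i [j [io jo Ox]]]; exists j, i. Qed.

Lemma sform_trans (V : measure_matrix R) f h : sform (mm_trans V) f h = sform V h f.
Proof.
rewrite /sform exchange_big; apply: eq_bigr => i _; apply: eq_bigr => j _ /=.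
by congr cintegral; apply/funext => x; rewrite mulrC.
Qed.

Lemma gram_trans (V : measure_matrix R) : gram (mm_trans V) = strans (gram V).
Proof. by apply/funext => i; apply/funext => j; exact: sform_trans. Qed.

(** A polynomial of the transposed matrix is the transpose, as powers commute. *)
Lemma Qinv_strans M i j : Qinv n q (strans M) i j = Qinv n q M j i.
Proof.
rewrite /Qinv maxnC trunc_strans.
have -> : horner_mx (trunc (maxn j i).+1 M)^T (Qpoly n q)
    = (horner_mx (trunc (maxn j i).+1 M) (Qpoly n q))^T.
  elim/poly_ind: (Qpoly n q) => [|p c IH]; first by rewrite !rmorph0 trmx0.
  rewrite !rmorphD !rmorphM /= !horner_mx_X !horner_mx_C linearD /= IH.
  rewrite tr_scalar_mx; congr (_ + _); rewrite -[RHS]/((_ *m _)^T).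
  by rewrite (comm_horner_mx p (comm_mx_refl _)) trmx_mul.
by rewrite -trmx_inv mxE.
Qed.

Lemma geronimusL_trans :
  mm_trans (geronimusL n q xi W) = geronimusR n q xiT (mm_trans W).
Proof.
rewrite /mm_trans /geronimusL /geronimusR /=; congr MeasureMatrix.
  apply/funext => i; apply/funext => j; congr caddC.
    apply: eq_bigr => m _; congr cdensity; apply/funext => x.
    by rewrite Qinv_strans.
  apply: eq_big => [k|k _]; first exact: andbC.
  by congr cscaleC; rewrite /strans [X in _ / X]mulrC.
by apply/funext => i; apply/funext => j; rewrite /deformed_supp /= mm_Omega_trans.
Qed.

Lemma gram_geronimusL :
  gram (geronimusR n q xiT (mm_trans W)) = strans (gram (geronimusL n q xi W)).
Proof. by rewrite -geronimusL_trans gram_trans. Qed.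

Lemma second_kind1_trans l : second_kind1 (mm_trans W) (lu_trans F) l = second_kind2 W F l.
Proof. by apply/funext => y; exact: sform_trans. Qed.

Lemma XiL_trans : XiL n q xi = XiR n q xiT.
Proof. by apply: eq_mxdiag => j; rewrite trunc_strans. Qed.

Lemma PhiL_trans l : PhiL n q xi W F l = PhiR n q xiT (mm_trans W) (lu_trans F) l.
Proof. by rewrite /PhiR second_kind1_trans -XiL_trans. Qed.

Lemma PhiL_block_trans l :
  PhiL_block n q xi W F l = PhiR_block n q xiT (mm_trans W) (lu_trans F) l.
Proof.
have E : PhiL n q xi W F = PhiR n q xiT (mm_trans W) (lu_trans F).
  by apply/funext => j; exact: PhiL_trans.
by rewrite /PhiL_block E.
Qed.

Lemma PiL_trans : PiL n q xi W F = PiR n q xiT (mm_trans W) (lu_trans F).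
Proof. by rewrite /PiL PhiL_block_trans. Qed.

Lemma kernel_rowL_trans k x :
  kernel_rowL n q xi W F k x = kernel_rowR n q xiT (mm_trans W) (lu_trans F) k x.
Proof.
have K1 : (fun y => mixed_kernel2 (mm_trans W) (lu_trans F) k x y)
    = (fun y => mixed_kernel1 W F k y x).
  apply/funext => y; apply: eq_bigr => j _.
  by rewrite second_kind1_trans mulrC mulrA mulrAC.
have K2 : (fun y => kernelK (lu_trans F) k x y) = (fun y => kernelK F k y x).
  by apply/funext => y; apply: eq_bigr => j _; rewrite mulrC mulrA mulrAC.
by rewrite /kernel_rowL /kernel_rowR XiL_trans K1 K2.
Qed.

End Transposition.

Theorem proposition23 (R : realType) (W : measure_matrix R)
    (s : nat) (n : 'I_s -> nat) (q : 'I_s -> R) (xi : 'I_s -> nat -> nat -> R)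
    (F FL FR : lu_data R) :
  let N := (\sum_(i < s) n i)%N in
  let h := lu_h F in
  let WL := geronimusL n q xi W in
  let WR := geronimusR n q xi W in
  let e0 : 'cV[R]_N := \col_(i < N) (i == 0%N :> nat)%:R in
  is_measure_matrix W ->
  (0 < s)%N ->
  (forall i, (0 < n i)%N) ->
  injective q ->
  (forall i, ~ mm_Omega W (q i)) ->
  LU_factorizable (gram W) ->
  LU_factorizable (gram WL) ->
  LU_factorizable (gram WR) ->
  LU_factorization (gram W) F ->
  LU_factorization (gram WL) FL ->
  LU_factorization (gram WR) FR ->
  [/\
    (* right deformation, k >= N *)
    forall k, (N <= k)%N ->
      let A := PhiR_block n q xi W F (k - N) in
      [/\ A \in unitmx,
          forall x, (poly1 FR k).[x] =
            Theta_star A (\col_(i < N) (poly1 F (k - N + i)).[x])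
                       (PhiR n q xi W F k) (poly1 F k).[x],
          lu_h FR k = h (k - N)%N * Theta_star A e0 (PhiR n q xi W F k) 0
        & forall x, (poly2 FR k).[x] / - h (k - N)%N =
            Theta_star A e0 (kernel_rowR n q xi W F k x) 0],
    (* left deformation, k >= N *)
    forall k, (N <= k)%N ->
      let A := PhiL_block n q xi W F (k - N) in
      [/\ A \in unitmx,
          forall x, (poly2 FL k).[x] =
            Theta_star A (\col_(i < N) (poly2 F (k - N + i)).[x])
                       (PhiL n q xi W F k) (poly2 F k).[x],
          lu_h FL k = h (k - N)%N * Theta_star A e0 (PhiL n q xi W F k) 0
        & forall x, (poly1 FL k).[x] / - h (k - N)%N =
            Theta_star A e0 (kernel_rowL n q xi W F k x) 0],
    Qmat n q *m germs_chi n q \in unitmx,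
    (* right deformation, k < N *)
    forall k : 'I_N,
      let w : 'I_k -> 'I_N := widen_ord (ltnW (ltn_ord k)) in
      let M := PiR n q xi W F in
      [/\ mxsub w w M \in unitmx,
          forall x, (poly1 FR k).[x] =
            Theta_star (mxsub w w M) (\col_(i < k) (poly1 F i).[x])
                       (\row_(j < k) M k (w j)) (poly1 F k).[x],
          forall x, (poly2 FR k).[x] =
            Theta_star (mxsub w w M^T) (\col_(i < k) x ^+ i)
                       (\row_(j < k) M^T k (w j)) (x ^+ k)
        & lu_h FR k =
            - Theta_star (mxsub w w M) (\col_(i < k) M (w i) k)
                         (\row_(j < k) M k (w j)) (M k k)]
    (* left deformation, k < N *)
  & forall k : 'I_N,
      let w : 'I_k -> 'I_N := widen_ord (ltnW (ltn_ord k)) in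
      let M := PiL n q xi W F in
      [/\ mxsub w w M \in unitmx,
          forall x, (poly2 FL k).[x] =
            Theta_star (mxsub w w M) (\col_(i < k) (poly2 F i).[x])
                       (\row_(j < k) M k (w j)) (poly2 F k).[x],
          forall x, (poly1 FL k).[x] =
            Theta_star (mxsub w w M^T) (\col_(i < k) x ^+ i)
                       (\row_(j < k) M^T k (w j)) (x ^+ k)
        & lu_h FL k =
            - Theta_star (mxsub w w M) (\col_(i < k) M (w i) k)
                         (\row_(j < k) M k (w j)) (M k k)]].
Proof.
move=> N h WL WR e0 measW s0 n0 q_inj qW facG facL facR luG luL luR.
have N0 : (0 < N)%N.
  by rewrite /N (bigD1 (Ordinal s0)) //= addn_gt0 n0.
have measWt := is_measure_matrix_trans measW.
have qWt i : ~ mm_Omega (mm_trans W) (q i) by rewrite mm_Omega_trans.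
have facGt : LU_factorizable (gram (mm_trans W)).
  by rewrite gram_trans; exact: LU_factorizable_strans.
have luGt : LU_factorization (gram (mm_trans W)) (lu_trans F).
  by rewrite gram_trans; exact: LU_factorization_strans.
have facLt := LU_factorizable_strans facL; rewrite -gram_geronimusL in facLt.
have luLt := LU_factorization_strans luL; rewrite -gram_geronimusL in luLt.
split.
- move=> k Nk.
  exact: (right_formulas_high measW q_inj qW facG facR luG luR N0 Nk).
- move=> k Nk; rewrite PhiL_block_trans PhiL_trans.
  have [uA p2 hk p1] := right_formulas_high measWt q_inj qWt facGt facLt luGt luLt N0 Nk.
  split; [exact: uA|exact: p2|exact: hk|].
  by move=> x; rewrite kernel_rowL_trans; exact: p1.
- exact: Qmat_germs_chi_unit.
- move=> k; exact: (right_formulas_low measW q_inj qW facG facR luG luR k).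
- move=> k; rewrite PiL_trans.
  exact: (right_formulas_low measWt q_inj qWt facGt facLt luGt luLt k).
Qed.
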